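(* The distributionally robust shortest path problem without linear expectation constraints, $$\min_{\mathbf{y} \in Y}\ \max_{\mathbb{Q} \in \widetilde{\mathcal{Q}}}\ \mathbb{E}_{\mathbb{Q}}\{\mathbf{c}^\top \mathbf{y}\},$$ is polynomially solvable, i.e., it can be solved in time polynomial in the size of its input (the graph $G$, the nodes $s,t$, and the data $l^{(i)}_a, u^{(i)}_a, \underline{q}^{(i)}_a, \overline{q}^{(i)}_a$ for $i \in \mathcal{D}_a$, $a \in A$).
   Context: $G=(N,A)$ is a finite directed connected graph with source node $s\in N$ and destination node $t\in N$. For $i\in N$, $RS_i$ (resp. $FS_i$) is the set of arcs directed out of (resp. into) node $i$. Path-incidence vectors: $Y=\{\mathbf{y}\in\{0,1\}^{|A|}: \mathbf{G}\mathbf{y}=\mathbf{g}\}$, where $G_{ia}=1$ if $a\in RS_i$, $G_{ia}=-1$ if $a\in FS_i$, $G_{ia}=0$ otherwise, and $g_s=1$, $g_t=-1$, $g_i=0$ for all other nodes $i$. The arc cost vector $\mathbf{c}=(c_a)_{a\in A}$ is random with joint distribution $\mathbb{Q}$. $\mathcal{Q}_0(\mathbb{R}^k)$ denotes the set of all probability distributions on $\mathbb{R}^k$; $\mathbb{Q}_a$ denotes the marginal distribution of $c_a$ induced by $\mathbb{Q}$. For each arc $a\in A$ there are given a support interval $[l_a,u_a]$ with $0\le l_a\le u_a<\infty$, an index set $\mathcal{D}_a=\{1,\dots,D_a\}$, subintervals $[l^{(i)}_a,u^{(i)}_a]\subseteq[l_a,u_a]$ and numbers $0\le \underline{q}^{(i)}_a\le\overline{q}^{(i)}_a\le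 1$, $i\in\mathcal{D}_a$. The last index $i=D_a$ is the support constraint: $l^{(D_a)}_a=l_a$, $u^{(D_a)}_a=u_a$, $\underline{q}^{(D_a)}_a=\overline{q}^{(D_a)}_a=1$. The ambiguity set is $$\widetilde{\mathcal{Q}}=\{\mathbb{Q}\in\mathcal{Q}_0(\mathbb{R}^{|A|}):\ \mathbb{Q}_a\{c_a\in[l^{(i)}_a,u^{(i)}_a]\}\in[\underline{q}^{(i)}_a,\overline{q}^{(i)}_a]\ \ \forall i\in\mathcal{D}_a,\ a\in A\}.$$ Standing assumptions. A1: for each $a\in A$ there exists a marginal distribution $\mathbb{Q}_a\in\mathcal{Q}_0(\mathbb{R})$ satisfying the constraints $\mathbb{Q}_a\{c_a\in[l^{(i)}_a,u^{(i)}_a]\}\in[\underline{q}^{(i)}_a,\overline{q}^{(i)}_a]$ for all $i\in\mathcal{D}_a$ and such that $\mathbb{Q}_a\{l^{(i)}_a\le c_a\le u^{(i)}_a\}\in(\underline{q}^{(i)}_a,\overline{q}^{(i)}_a)$ whenever $\underline{q}^{(i)}_a<\overline{q}^{(i)}_a$, $i\in\mathcal{D}_a$. A2: for each $a\in A$ and any pair $i_1,i_2\in\mathcal{D}_a$ we have $l^{(i_1)}_a\ne u^{(i_2)}_a$ and $l^{(i_2)}_a\ne u^{(i_1)}_a$. Numerical input data are rational and encoded in binary, as usual in complexity statements. *)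

(* Defs.v *)
(* MathComp / MathComp-Analysis *)
From mathcomp Require Import all_boot all_order all_algebra.
From mathcomp Require Import all_classical all_reals all_analysis.

Set Implicit Arguments.
Unset Strict Implicit.
Unset Printing Implicit Defensive.

Import Order.TTheory GRing.Theory Num.Theory.

Local Open Scope ring_scope.
Local Open Scope classical_set_scope.

(******************************************************************************)
(* Polynomial time is measured on the random access machine of Aho, Hopcroft  *)
(* and Ullman under the logarithmic cost criterion: a finite program of       *)
(* elementary instructions acts on registers holding integers, and every      *)
(* executed instruction is charged the binary lengths of all the addresses    *)
(* and integers it reads. This is polynomially equivalent to the Turing       *)
(* machine (the result of an arithmetic instruction is never longer than the  *)
(* total length of its arguments, plus a constant).                           *)
(******************************************************************************)

(* As trunc_log 2 0 = 0, every integer, zero included, has positive length. *)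
Definition bitlen (z : int) : nat := (trunc_log 2 `|z|%N).+1.

(* Registers are addressed by arbitrary integers, so that indirect addressing *)
(* never fails.                                                               *)
Definition memory := int -> int.

Inductive location := Direct of int | Indirect of int.

Inductive operand := Const of int | At of location.

Inductive arith := Add | Sub | Mul | Div.

Inductive instr :=
  | Move of location & operand
  | Compute of arith & location & operand & operand
  | JumpPos of operand & nat.

Definition program := seq instr.

Definition address (m : memory) (p : location) : int :=
  match p with Direct i => i | Indirect i => m i end.

Definition value (m : memory) (x : operand) : int :=
  match x with Const z => z | At p => m (address m p) end.

(* Division is Euclidean, and z / 0 = 0. *)
Definition arith_fun (f : arith) (x y : int) : int :=
  match f with
  | Add => x + y
  | Sub => x - y
  | Mul => x * y
  | Div => (x %/ y)%Z
  end.

Definition update (m : memory) (i z : int) : memory :=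
  fun j => if j == i then z else m j.

Definition next (c : instr) (pc : nat) (m : memory) : nat * memory :=
  match c with
  | Move p x => (pc.+1, update m (address m p) (value m x))
  | Compute f p x y =>
      (pc.+1, update m (address m p) (arith_fun f (value m x) (value m y)))
  | JumpPos x l => (if 0 < value m x then l else pc.+1, m)
  end.

Definition location_cost (m : memory) (p : location) : nat :=
  match p with
  | Direct i => bitlen i
  | Indirect i => bitlen i + bitlen (m i)
  end.

Definition operand_cost (m : memory) (x : operand) : nat :=
  match x with
  | Const z => bitlen z
  | At p => location_cost m p + bitlen (m (address m p))
  end.

Definition instr_cost (m : memory) (c : instr) : nat :=
  match c with
  | Move p x => location_cost m p + operand_cost m x
  | Compute _ p x y => location_cost m p + operand_cost m x + operand_cost m y
  | JumpPos x _ => operand_cost m x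
  end.

(* [exec P pc m t m']: started at instruction pc with memory m, the program P *)
(* stops with memory m' after total cost t. It stops when the instruction     *)
(* pointer leaves the program.                                                *)
Inductive exec (P : program) : nat -> memory -> nat -> memory -> Prop :=
  | exec_halt pc m : (size P <= pc)%N -> exec P pc m 0 m
  | exec_step pc m c t m' :
      onth P pc = Some c ->
      exec P (next c pc m).1 (next c pc m).2 t m' ->
      exec P pc m (instr_cost m c + t) m'.

(* The input word occupies registers 0, 1, ..., (size w).-1; all the other    *)
(* registers, including those with a negative address, initially hold 0.      *)
Definition input_memory (w : seq int) : memory :=
  fun z => match z with Posz i => w`_i | Negz _ => 0 end.

(* The output word is likewise read off from register 0 on; its length must   *)
(* be determined by the word itself.                                          *)
Definition output_word (m : memory) (w : seq int) : Prop :=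
  forall i : nat, (i < size w)%N -> m i%:Z = w`_i.

Definition word_size (w : seq int) : nat := (\sum_(z <- w) bitlen z)%N.

(* The instances of the problem are the x : I such that [valid x]. *)
Definition polynomially_solvable (I : Type) (encode : I -> seq int)
    (valid : I -> Prop) (solution : I -> seq int -> Prop) : Prop :=
  exists (P : program) (b k : nat), forall x : I, valid x ->
    exists (t : nat) (m : memory) (w : seq int),
      [/\ exec P 0 (input_memory (encode x)) t m,
          (t <= b * word_size (encode x) ^ k + b)%N,
          output_word m w
        & solution x w].

(* Parallel arcs are allowed. The constraints of arc a are numbered from 0 to *)
(* nextra a, i.e. D_a = (nextra a).+1, and ord_max is the support constraint; *)
(* thus the support interval is [lo a ord_max, up a ord_max].                 *)
Record instance := Instance {
  nnodes : nat;
  narcs : nat;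
  arc_tail : 'I_narcs -> 'I_nnodes;
  arc_head : 'I_narcs -> 'I_nnodes;
  src : 'I_nnodes;
  dst : 'I_nnodes;
  nextra : 'I_narcs -> nat;
  lo : forall a, 'I_(nextra a).+1 -> rat;
  up : forall a, 'I_(nextra a).+1 -> rat;
  qlo : forall a, 'I_(nextra a).+1 -> rat;
  qup : forall a, 'I_(nextra a).+1 -> rat
}.

Definition encode_rat (r : rat) : seq int := [:: numq r; denq r].

Definition encode_constraint (x : instance) (a : 'I_(narcs x))
    (i : 'I_(nextra a).+1) : seq int :=
  encode_rat (lo i) ++ encode_rat (up i) ++
  encode_rat (qlo i) ++ encode_rat (qup i).

Definition encode_arc (x : instance) (a : 'I_(narcs x)) : seq int :=
  [:: Posz (arc_tail a); Posz (arc_head a); Posz (nextra a).+1] ++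
  flatten [seq encode_constraint i | i <- enum 'I_(nextra a).+1].

Definition encode_instance (x : instance) : seq int :=
  [:: Posz (nnodes x); Posz (narcs x); Posz (src x); Posz (dst x)] ++
  flatten [seq encode_arc a | a <- enum 'I_(narcs x)].

Section Graph.
Variable x : instance.

Definition adjacent : rel 'I_(nnodes x) :=
  fun i j => [exists a, ((arc_tail a == i) && (arc_head a == j)) ||
                        ((arc_tail a == j) && (arc_head a == i))].

(* Connectedness is that of the underlying undirected graph, so dst need not  *)
(* be reachable from src. Loops are excluded since their column of the        *)
(* incidence matrix is not defined.                                           *)
Definition valid_graph : Prop :=
  [/\ forall i j : 'I_(nnodes x), connect adjacent i j,
      forall a : 'I_(narcs x), arc_tail a != arc_head a
    & src x != dst x].

Definition incidence : 'M[int]_(nnodes x, narcs x) :=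
  \matrix_(i, a) (if i == arc_tail a then 1 else if i == arc_head a then -1 else 0).

Definition balance : 'cV[int]_(nnodes x) :=
  \col_i (if i == src x then 1 else if i == dst x then -1 else 0).

Definition path_vectors : set 'cV[int]_(narcs x) :=
  [set y : 'cV[int]_(narcs x) | (forall a, y a 0 = 0 \/ y a 0 = 1) /\ incidence *m y = balance].

End Graph.

Section Ambiguity.
Variables (R : realType) (x : instance).

Definition valid_data : Prop := forall a : 'I_(narcs x),
  [/\ 0 <= lo (ord_max : 'I_(nextra a).+1),
      qlo (ord_max : 'I_(nextra a).+1) = 1,
      qup (ord_max : 'I_(nextra a).+1) = 1
    & forall i : 'I_(nextra a).+1,
        [/\ lo (ord_max : 'I_(nextra a).+1) <= lo i, lo i <= up i
          & up i <= up (ord_max : 'I_(nextra a).+1)] /\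
        [/\ 0 <= qlo i, qlo i <= qup i & qup i <= 1]].

Definition subinterval (a : 'I_(narcs x)) (i : 'I_(nextra a).+1) : set R :=
  [set z | ratr (lo i) <= z <= ratr (up i)].

Definition marginal_constraints (a : 'I_(narcs x)) (mu : set R -> \bar R) :
    Prop :=
  forall i : 'I_(nextra a).+1,
    ((ratr (qlo i))%:E <= mu (subinterval i) <= (ratr (qup i))%:E)%E.

Definition marginal (Q : probability ((narcs x).-tuple R) R)
    (a : 'I_(narcs x)) : set R -> \bar R :=
  pushforward Q (fun c : (narcs x).-tuple R => tnth c a).

Definition ambiguity_set : set (probability ((narcs x).-tuple R) R) :=
  [set Q | forall a, marginal_constraints a (marginal Q a)].

Definition assumption_A1 : Prop := forall a : 'I_(narcs x),
  exists mu : probability R R,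
    marginal_constraints a mu /\
    forall i : 'I_(nextra a).+1, qlo i < qup i ->
      ((ratr (qlo i))%:E < mu (subinterval i) < (ratr (qup i))%:E)%E.

Definition assumption_A2 : Prop :=
  forall (a : 'I_(narcs x)) (i1 i2 : 'I_(nextra a).+1),
    lo i1 <> up i2 /\ lo i2 <> up i1.

Definition path_cost (y : 'cV[int]_(narcs x)) (c : (narcs x).-tuple R) : R :=
  \sum_(a < narcs x) tnth c a * (y a 0)%:~R.

(* The subintervals being closed, the maximum over the ambiguity set need not *)
(* be attained; it is to be understood as a supremum.                         *)
Definition worst_case_cost (y : 'cV[int]_(narcs x)) : \bar R :=
  ereal_sup [set 'E_Q[path_cost y] | Q in ambiguity_set]%E.

Definition optimal_value : \bar R :=
  ereal_inf [set worst_case_cost y | y in @path_vectors x].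

(* Output 0 if there is no path, and otherwise 1, a numerator and a           *)
(* denominator of the optimal value, and the entries of an optimal y.         *)
Definition drsp_solution (w : seq int) : Prop :=
  (@path_vectors x = set0 /\ w = [:: 0]) \/
  exists (y : 'cV[int]_(narcs x)) (p q : int),
    [/\ @path_vectors x y,
        worst_case_cost y = optimal_value,
        0 < q,
        optimal_value = ((p%:~R / q%:~R)%:E)%E
      & w = [:: 1; p; q] ++ [seq y a 0 | a <- enum 'I_(narcs x)]].

End Ambiguity.

Definition drsp_valid (R : realType) (x : instance) : Prop :=
  [/\ valid_graph x, valid_data x, assumption_A1 R x & assumption_A2 x].

(* Main.v *)
From mathcomp Require Import all_boot all_order all_algebra.
From mathcomp Require Import all_classical all_reals all_analysis.
From mathcomp Require Import measurable_realfun zify ring lra.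
Require Import Defs.

Set Implicit Arguments.
Unset Strict Implicit.
Unset Printing Implicit Defensive.

Import Order.TTheory GRing.Theory Num.Theory.

(** Fix an arc, and look at a law of its cost only through the probabilities of
    lying strictly before the left end points and weakly before the right end
    points of its subintervals. Since no left end point equals a right one,
    these numbers are exactly constrained by differences: they increase with
    the end point, and the increase over each subinterval lies between two
    bounds. A system of difference constraints that has a solution has a least
    nonnegative one, which Bellman-Ford relaxation finds ([relaxed_closed],
    [relaxed_dominated]). The least distribution function belongs to the
    stochastically largest law, so its mean is the worst-case expected cost of
    the arc: no law does better ([arc_expectation_le]), and a law with atoms
    just before the end points comes as close as one likes.

    The ambiguity set constrains the marginals only, so all arcs can be driven
    to their worst case at once, by a coupling in which all costs are quantiles
    of one uniform level ([worst_law_ambiguous], [expectation_worst_law]). Hence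
    the worst-case cost of a path is the sum of the worst-case costs of its arcs
    ([worst_case_costE]), and what remains is a shortest path problem with
    nonnegative lengths.

    That problem is solved by the same relaxation, for the lengths
    [C * (A + 1) + 1], where [C] is the scaled cost of an arc and [A] the number
    of arcs. The potential is a dual solution and bounds every path vector from
    below ([price_ge]). The lengths are positive, so following tight arcs from
    the source raises the potential at each step, never repeats an arc and ends
    at the destination ([walk_step], [walk_path]); a shortest path for these
    lengths is also one for the costs ([marks_optimal]).

    All computations are on natural numbers: the data are multiplied by the
    product [D] of all denominators, which is no longer than the input. The law
    is then uniform on [D] levels, and its mean is a count ([sum_quantile]).

    For the running time, the algorithm is written in a small language whose
    loops fix their number of iterations on entry, and compiled to the random
    access machine. If every loop bound is polynomial in the size of the input
    and every right factor of a product is at most as long as the input plus a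
    constant, then the number of steps is polynomial, and so are the lengths of
    all integers, because a step adds a bounded number of bits
    ([compiled_polynomially_solvable]). *)

(** * Runs of the random access machine *)

Section Steps.
Local Open Scope nat_scope.

(** The only instruction that can make integers grow fast is a product; a step
    is tame when its right factor is below [2 ^ G], so that every step adds at
    most [G] bits. *)
Definition tame (G : nat) (m : memory) (c : instr) : bool :=
  match c with
  | Compute Mul _ _ y => `|value m y|%N < 2 ^ G
  | _ => true
  end.

Inductive runs (P : program) (G : nat) : nat -> nat -> memory -> nat -> memory -> Prop :=
  | runs_refl pc m : runs P G 0 pc m pc m
  | runs_step n pc m c pc' m' :
      onth P pc = Some c -> tame G m c ->
      runs P G n (next c pc m).1 (next c pc m).2 pc' m' ->
      runs P G n.+1 pc m pc' m'.

Lemma runs_trans P G n1 n2 pc1 m1 pc2 m2 pc3 m3 :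
  runs P G n1 pc1 m1 pc2 m2 -> runs P G n2 pc2 m2 pc3 m3 ->
  runs P G (n1 + n2) pc1 m1 pc3 m3.
Proof.
elim=> [//|n pc m c pc' m' Pc tc _ IH] r2.
by rewrite addSn; apply: runs_step Pc tc (IH r2).
Qed.

Lemma runs_one P G c pc m pc' m' :
  onth P pc = Some c -> tame G m c -> next c pc m = (pc', m') ->
  runs P G 1 pc m pc' m'.
Proof.
by move=> Pc tc nc; apply: (runs_step Pc tc); rewrite nc; apply: runs_refl.
Qed.

Definition fits (b : nat) (m : memory) : Prop := forall i, `|m i|%N < 2 ^ b.

Definition location_literal (p : location) : int :=
  match p with Direct i => i | Indirect i => i end.

Definition operand_literal (x : operand) : int :=
  match x with Const z => z | At p => location_literal p end.

Definition instr_literals (c : instr) : seq int :=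
  match c with
  | Move p x => [:: location_literal p; operand_literal x]
  | Compute _ p x y => [:: location_literal p; operand_literal x; operand_literal y]
  | JumpPos x _ => [:: operand_literal x]
  end.

Definition literals_fit (b : nat) (c : instr) : bool :=
  all (fun z : int => `|z|%N < 2 ^ b) (instr_literals c).

Lemma literals_fit_le b b' c : b <= b' -> literals_fit b c -> literals_fit b' c.
Proof.
move=> le_b; apply: sub_all => z zb; apply: leq_trans zb _.
by rewrite leq_exp2l.
Qed.

Lemma bitlen_le b (z : int) : `|z|%N < 2 ^ b -> bitlen z <= b.+1.
Proof.
move=> zb; rewrite /bitlen ltnS.
case: (posnP `|z|%N) => [->|z0]; first by rewrite trunc_log0.
rewrite -(@leq_exp2l 2) //; apply: leq_trans (ltnW zb).
exact: trunc_logP.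
Qed.

Lemma value_fits b m x : `|operand_literal x|%N < 2 ^ b -> fits b m -> `|value m x|%N < 2 ^ b.
Proof. by case: x => [z|p] //= _ mb. Qed.

Lemma location_cost_le b m p : `|location_literal p|%N < 2 ^ b -> fits b m ->
  location_cost m p <= 2 * b.+1.
Proof.
case: p => i /= ib mb; have := bitlen_le ib; first lia.
have := bitlen_le (mb i); lia.
Qed.

Lemma operand_cost_le b m x : `|operand_literal x|%N < 2 ^ b -> fits b m ->
  operand_cost m x <= 3 * b.+1.
Proof.
case: x => [z|p] /= xb mb; first by have := bitlen_le xb; lia.
have := location_cost_le xb mb; have := bitlen_le (mb (address m p)); lia.
Qed.

Lemma instr_cost_le b m c : literals_fit b c -> fits b m -> instr_cost m c <= 8 * b.+1.
Proof.
case: c => [p x|f p x y|x l]; rewrite /literals_fit /=.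
- case/and3P=> pb xb _ mb.
  have := location_cost_le pb mb; have := operand_cost_le xb mb; lia.
- case/and4P=> pb xb yb _ mb.
  have := location_cost_le pb mb; have := operand_cost_le xb mb.
  have := operand_cost_le yb mb; lia.
- by case/andP=> xb _ mb; have := operand_cost_le xb mb; lia.
Qed.

Lemma update_fits b m p z : fits b m -> `|z|%N < 2 ^ b -> fits b (update m p z).
Proof. by move=> mb zb i; rewrite /update; case: eqP. Qed.

Lemma fits_le b b' m : b <= b' -> fits b m -> fits b' m.
Proof. by move=> le_b mb i; apply: leq_trans (mb i) _; rewrite leq_exp2l. Qed.

Lemma absz_divz_le (x y : int) : `|(x %/ y)%Z|%N <= `|x|%N.
Proof. by have := lez_div x y; lia. Qed.

Lemma next_fits b G m c pc : 0 < G -> literals_fit b c -> fits b m -> tame G m c ->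
  fits (b + G) (next c pc m).2.
Proof.
move=> G0 cb mb; have mbG : fits (b + G) m by apply: fits_le mb; lia.
have bG : 2 ^ b + 2 ^ b <= 2 ^ (b + G).
  by rewrite addnn -mul2n -expnS leq_exp2l //; lia.
case: c cb => [p x|f p x y|x l] //; rewrite /literals_fit /=.
  case/and3P=> _ xb _ _; apply: update_fits => //.
  by have := value_fits xb mb; lia.
case/and4P=> _ xb yb _ tc; apply: update_fits => //.
have vx := value_fits xb mb; have vy := value_fits yb mb.
case: f tc => /= tc; [lia | lia | |].
- by rewrite abszM expnD ltn_mul.
- by have := absz_divz_le (value m x) (value m y); lia.
Qed.

(** Each of the [n] tame steps reads at most eight integers, all of them of at
    most [b + n * G] bits. *)
Lemma runs_exec P G n b pc m pc' m' : 0 < G -> all (literals_fit b) P ->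
  fits b m -> runs P G n pc m pc' m' -> size P <= pc' ->
  exists2 t, exec P pc m t m' & t <= n * (8 * (b + n * G).+1).
Proof.
move=> G0 Pb mb r; elim: r b Pb mb => {n pc m pc' m'} [pc m b Pb mb le_pc|].
  by exists 0 => //; apply: exec_halt.
move=> n pc m c pc' m' Pc tc _ IH b Pb mb le_pc.
have cb : literals_fit b c.
  have := all_nthP c Pb pc; rewrite (@onth_nth _ c c _ _ Pc); apply.
  by rewrite -onthTE Pc.
have [|t ex le_t] := IH (b + G) _ (next_fits _ G0 cb mb tc) le_pc.
  by apply: sub_all Pb => z; apply: literals_fit_le; lia.
exists (instr_cost m c + t); first exact: exec_step Pc ex.
have := instr_cost_le cb mb; nia.
Qed.

End Steps.

(** * A loop language and its compiler *)

Section Language.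
Local Open Scope nat_scope.

(** [IO] holds the input word and receives the output word. *)
Inductive array :=
  | IO | Den | Ptr | Off | Arc | Idx | Base | Cons | Scaled | Val
  | From | Into | Inc | Dec | Pot | NumEdges | Round | Edge | Cur | Next
  | Cdf | Area | NumNodes | Price | Big | Chosen | Narcs | Src | Dst | Here.

Definition code (a : array) : nat :=
  match a with
  | IO => 0 | Den => 1 | Ptr => 2 | Off => 3 | Arc => 4 | Idx => 5
  | Base => 6 | Cons => 7 | Scaled => 8 | Val => 9 | From => 10 | Into => 11
  | Inc => 12 | Dec => 13 | Pot => 14 | NumEdges => 15 | Round => 16 | Edge => 17
  | Cur => 18 | Next => 19 | Cdf => 20 | Area => 21 | NumNodes => 22 | Price => 23
  | Big => 24 | Chosen => 25 | Narcs => 26 | Src => 27 | Dst => 28 | Here => 29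
  end.

Lemma code_inj : injective code.
Proof. by case; case. Qed.

Lemma code_lt a : code a < 32.
Proof. by case: a. Qed.

(** An array is unbounded; a scalar variable is the entry [0] of its array. *)
Definition store := array -> nat -> nat.

Definition upd (s : store) (a : array) (i v : nat) : store :=
  fun b => if code b == code a then fun j => if j == i then v else s b j else s b.

Inductive expr := Num of nat | Ld of array & expr | Op of arith & expr & expr.

(** Subtraction is truncated: all quantities of the algorithm are nonnegative. *)
Definition op_fun (o : arith) : nat -> nat -> nat :=
  match o with Add => addn | Sub => subn | Mul => muln | Div => divn end.

Fixpoint ev (s : store) (e : expr) : nat :=
  match e with
  | Num n => n
  | Ld a e => s a (ev s e)
  | Op o e1 e2 => op_fun o (ev s e1) (ev s e2)
  end.

Inductive cmd :=
  | Asg of array & expr & expr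
  | Seq of cmd & cmd
  | If of expr & cmd & cmd
  | For of array & expr & cmd.

(** The number of iterations of a loop is fixed on entry, so that every command
    terminates and denotes a total function. *)
Fixpoint run (c : cmd) (s : store) : store :=
  match c with
  | Asg a e1 e2 => upd s a (ev s e1) (ev s e2)
  | Seq c1 c2 => run c2 (run c1 s)
  | If e c1 c2 => if 0 < ev s e then run c1 s else run c2 s
  | For i e c => iteri (ev s e) (fun k s => run c (upd s i 0 k)) s
  end.

Variables S G : nat.

Fixpoint safe_expr (s : store) (e : expr) : Prop :=
  match e with
  | Num _ => True
  | Ld _ e => safe_expr s e
  | Op o e1 e2 =>
      [/\ safe_expr s e1, safe_expr s e2 & match o with Mul => ev s e2 < 2 ^ G | _ => True end]
  end.

(** Running time is polynomial when loops are short ([S]) and products have a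
    short right factor ([G]); these are the only conditions that execution
    depends on. *)
Fixpoint safe (c : cmd) (s : store) : Prop :=
  match c with
  | Asg a e1 e2 => safe_expr s e1 /\ safe_expr s e2
  | Seq c1 c2 => safe c1 s /\ safe c2 (run c1 s)
  | If e c1 c2 => safe_expr s e /\ if 0 < ev s e then safe c1 s else safe c2 s
  | For i e c =>
      [/\ safe_expr s e, ev s e <= S
        & forall k, k < ev s e ->
            safe c (upd (iteri k (fun k s => run c (upd s i 0 k)) s) i 0 k)]
  end.

(** [IO] lies where the machine reads and writes words. The other arrays are
    interleaved at negative addresses, one residue class modulo 32 each; the
    class of zero is left to the hidden registers of compiled code. *)
Definition addr (a : array) (i : nat) : int :=
  if code a == 0 then Posz i else (- Posz (32 * i + code a))%R.

Definition hidden (j : nat) : int := (- Posz (32 * j.+1))%R.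

Definition reg (j : nat) : operand := At (Direct (hidden j)).

Lemma addr_inj a i b j : addr a i = addr b j -> code a = code b /\ i = j.
Proof. by rewrite /addr; have := code_lt a; have := code_lt b; do 2 case: eqP; lia. Qed.

Lemma addr_hidden a i j : addr a i <> hidden j.
Proof. by rewrite /addr /hidden; have := code_lt a; case: eqP; lia. Qed.

Lemma hidden_inj i j : hidden i = hidden j -> i = j.
Proof. by rewrite /hidden; lia. Qed.

Definition address_code (a : array) (d : nat) : seq instr :=
  if code a == 0 then [::] else
    [:: Compute Mul (Direct (hidden d)) (reg d) (Const 32);
        Compute Sub (Direct (hidden d)) (Const (- Posz (code a))%R) (reg d)].

(** The machine subtracts integers: a difference that is not positive is
    overwritten by zero. *)
Definition op_code (o : arith) (d pc : nat) : seq instr :=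
  Compute o (Direct (hidden d)) (reg d) (reg d.+1) ::
  if o is Sub then [:: JumpPos (reg d) (pc + 3); Move (Direct (hidden d)) (Const 0)] else [::].

(** The hidden registers form a stack: code of depth [d] leaves its value in
    register [d] and uses no register below. *)
Fixpoint expr_code (d pc : nat) (e : expr) : seq instr :=
  match e with
  | Num n => [:: Move (Direct (hidden d)) (Const n)]
  | Ld a e => expr_code d pc e ++ (address_code a d ++ [:: Move (Direct (hidden d)) (At (Indirect (hidden d)))])
  | Op o e1 e2 =>
      let c1 := expr_code d pc e1 in
      let c2 := expr_code d.+1 (pc + size c1) e2 in
      c1 ++ (c2 ++ op_code o d (pc + size c1 + size c2))
  end.

(** A loop keeps its counter and its bound in the hidden registers [d] and
    [d + 1], out of reach of its body, which has depth [d + 2]. *)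
Fixpoint cmd_code (d pc : nat) (c : cmd) : seq instr :=
  match c with
  | Asg a e1 e2 =>
      let c1 := expr_code d pc e1 in
      let c2 := expr_code d.+1 (pc + size c1 + size (address_code a d)) e2 in
      c1 ++ (address_code a d ++ (c2 ++ [:: Move (Indirect (hidden d)) (reg d.+1)]))
  | Seq c1 c2 => let p1 := cmd_code d pc c1 in p1 ++ cmd_code d (pc + size p1) c2
  | If e c1 c2 =>
      let p0 := expr_code d pc e in
      let p2 := cmd_code d (pc + size p0).+1 c2 in
      let l1 := ((pc + size p0).+1 + size p2).+1 in
      let p1 := cmd_code d l1 c1 in
      p0 ++ JumpPos (reg d) l1 :: (p2 ++ JumpPos (Const 1) (l1 + size p1) :: p1)
  | For i e c =>
      let p0 := expr_code d.+1 pc e in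
      let l := (pc + size p0).+1 in
      let b := cmd_code d.+2 l.+4 c in
      p0 ++ [:: Move (Direct (hidden d)) (Const 0),
                Compute Sub (Direct (hidden d.+2)) (reg d.+1) (reg d),
                JumpPos (reg d.+2) l.+3,
                JumpPos (Const 1) (l.+4 + size b).+2,
                Move (Direct (addr i 0)) (reg d) &
            b ++ [:: Compute Add (Direct (hidden d)) (reg d) (Const 1);
                     JumpPos (Const 1) l]]
  end.

Definition code_at (P : program) (pc : nat) (c : seq instr) : Prop :=
  forall i, i < size c -> onth P (pc + i) = onth c i.

Lemma code_at_cat P pc c1 c2 :
  code_at P pc (c1 ++ c2) -> code_at P pc c1 /\ code_at P (pc + size c1) c2.
Proof.
move=> H; split=> i ic; have := H.
  by move/(_ i); rewrite size_cat onth_cat ic; apply; lia.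
move/(_ (size c1 + i)); rewrite size_cat onth_cat addnA.
have -> : (size c1 + i < size c1) = false by lia.
by rewrite addKn; apply; lia.
Qed.

Lemma code_at_cons P pc x c : code_at P pc (x :: c) -> onth P pc = Some x /\ code_at P pc.+1 c.
Proof.
move=> H; split; first by have := H 0 isT; rewrite addn0.
by move=> i ic; have := H i.+1 ic; rewrite addnS addSn.
Qed.

Definition represents (s : store) (m : memory) : Prop := forall a i, m (addr a i) = Posz (s a i).

Definition hidden_below (d : nat) (m m' : memory) : Prop := forall j, j < d -> m' (hidden j) = m (hidden j).

Lemma hidden_below_trans d m1 m2 m3 :
  hidden_below d m1 m2 -> hidden_below d m2 m3 -> hidden_below d m1 m3.
Proof. by move=> H1 H2 j jd; rewrite H2 ?H1. Qed.

Lemma update_same m p z : update m p z p = z.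
Proof. by rewrite /update eqxx. Qed.

Lemma represents_hidden s m j z : represents s m -> represents s (update m (hidden j) z).
Proof. by move=> H a i; rewrite /update; case: eqP => [/addr_hidden|_] //; apply: H. Qed.

Lemma hidden_below_hidden d j m z : d <= j -> hidden_below d m (update m (hidden j) z).
Proof. by move=> dj i id; rewrite /update; case: eqP => // /hidden_inj; lia. Qed.

Lemma represents_upd s m a i v : represents s m ->
  represents (upd s a i v) (update m (addr a i) (Posz v)).
Proof.
move=> H b j; rewrite /update /upd; case: eqP => [/addr_inj [-> ->]|ne].
  by rewrite !eqxx.
case: eqP => [cab|_]; last exact: H.
case: eqP => [ij|_]; last exact: H.
by case: ne; rewrite ij (code_inj cab).
Qed.

Lemma hidden_below_addr d m a i z : hidden_below d m (update m (addr a i) z).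
Proof. by move=> j _; rewrite /update; case: eqP => // /esym /addr_hidden. Qed.

(** The guarantee given for a piece of code. The hidden registers below [d]
    belong to the code around it. *)
Definition effect P d pc m n pc' s m' : Prop :=
  [/\ exists2 k, k <= n & runs P G k pc m pc' m', represents s m' & hidden_below d m m'].

Lemma effect_refl P d pc m s : represents s m -> effect P d pc m 0 pc s m.
Proof. by move=> ms; split=> //; exists 0 => //; apply: runs_refl. Qed.

Lemma effect_trans P d pc1 m1 n1 pc2 s1 m2 n2 pc3 s2 m3 :
  effect P d pc1 m1 n1 pc2 s1 m2 -> effect P d pc2 m2 n2 pc3 s2 m3 ->
  effect P d pc1 m1 (n1 + n2) pc3 s2 m3.
Proof.
case=> [[k1 k1n r1] _ h1] [[k2 k2n r2] s h2]; split=> //.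
  by exists (k1 + k2); [lia | apply: runs_trans r1 r2].
exact: hidden_below_trans h1 h2.
Qed.

Lemma effectW P d d' pc m n n' pc' s m' : d' <= d -> n <= n' ->
  effect P d pc m n pc' s m' -> effect P d' pc m n' pc' s m'.
Proof.
move=> dd nn [[k kn r] ms h]; split=> //; first by exists k => //; lia.
by move=> j jd; apply: h; lia.
Qed.

Lemma effect_hidden P d pc m s c j z pc' : d <= j ->
  onth P pc = Some c -> tame G m c -> next c pc m = (pc', update m (hidden j) z) ->
  represents s m -> effect P d pc m 1 pc' s (update m (hidden j) z).
Proof.
move=> dj Pc tc nc ms; split; last exact: hidden_below_hidden.
  by exists 1 => //; apply: runs_one Pc tc nc.
exact: represents_hidden.
Qed.

Lemma effect_jump P d pc m s c pc' :
  onth P pc = Some c -> tame G m c -> next c pc m = (pc', m) ->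
  represents s m -> effect P d pc m 1 pc' s m.
Proof. by move=> Pc tc nc ms; split=> //; exists 1 => //; apply: runs_one Pc tc nc. Qed.

(** Computing an address multiplies by 32, which must be below [2 ^ G]. *)
Hypothesis G_gt5 : 5 < G.

Lemma address_code_correct P d pc s m a i : code_at P pc (address_code a d) -> represents s m ->
  m (hidden d) = Posz i ->
  exists2 m', effect P d pc m (size (address_code a d)) (pc + size (address_code a d)) s m'
            & m' (hidden d) = addr a i.
Proof.
rewrite /address_code /addr; case: eqP => [_ _ ms mi|_].
  by exists m => //; rewrite addn0; apply: effect_refl.
case/code_at_cons=> P0 /code_at_cons [P1 _] ms mi.
have t32 : tame G m (Compute Mul (Direct (hidden d)) (reg d) (Const 32)).
  by apply: (@leq_trans (2 ^ 6)) => //; rewrite leq_exp2l.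
have e1 := effect_hidden (leqnn d) P0 t32 erefl ms.
have [_ ms1 _] := e1.
have e2 := effect_hidden (leqnn d) P1 isT erefl ms1.
exists (update (update m (hidden d) (m (hidden d) * 32)%R) (hidden d)
  (- Posz (code a) - (m (hidden d) * 32))%R).
  have := effect_trans e1 e2; rewrite /= update_same addn2; exact.
by rewrite update_same mi; lia.
Qed.

Lemma op_code_correct P d pc s m o u v : code_at P pc (op_code o d pc) -> represents s m ->
  m (hidden d) = Posz u -> m (hidden d.+1) = Posz v ->
  (if o is Mul then v < 2 ^ G else true) ->
  exists2 m', effect P d pc m (size (op_code o d pc)) (pc + size (op_code o d pc)) s m'
            & m' (hidden d) = Posz (op_fun o u v).
Proof.
rewrite /op_code => /code_at_cons [P0 P1] ms mu mv sv.
have tO : tame G m (Compute o (Direct (hidden d)) (reg d) (reg d.+1)).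
  by case: o sv {P0 P1} => //=; rewrite mv.
have e1 := effect_hidden (leqnn d) P0 tO erefl ms.
case: o sv P0 P1 tO e1 => /= _ P0 P1 _ e1.
- exists (update m (hidden d) (m (hidden d) + m (hidden d.+1))%R); first by rewrite addn1.
  by rewrite update_same mu mv.
- case/code_at_cons: P1 => P1 /code_at_cons [P2 _].
  have [_ ms1 _] := e1; set m1 := update _ _ _ in e1 ms1.
  have m1d : m1 (hidden d) = (Posz u - Posz v)%R by rewrite /m1 update_same mu mv.
  case: (ltnP v u) => uv.
    exists m1; last by rewrite m1d; lia.
    apply: (@effectW _ d _ _ _ (1 + 1)) => //; apply: (effect_trans e1).
    apply: (effect_jump d P1) => //=; rewrite m1d.
    by have -> : (0 < Posz u - Posz v)%R by lia.
  exists (update m1 (hidden d) 0); last by rewrite update_same; lia.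
  apply: (effectW (leqnn d) (n := 1 + (1 + 1))) => //; apply: (effect_trans e1).
  apply: effect_trans (effect_hidden (leqnn d) P2 isT _ ms1).
    apply: (effect_jump d P1) => //=; rewrite m1d.
    by have -> : (0 < Posz u - Posz v)%R = false by lia.
  by rewrite /= addn3.
- exists (update m (hidden d) (m (hidden d) * m (hidden d.+1))%R); first by rewrite addn1.
  by rewrite update_same mu mv.
- exists (update m (hidden d) (m (hidden d) %/ m (hidden d.+1))%Z); first by rewrite addn1.
  by rewrite update_same mu mv divz_nat.
Qed.

Lemma expr_code_correct P e d pc s m : code_at P pc (expr_code d pc e) -> represents s m ->
  safe_expr s e ->
  exists2 m', effect P d pc m (size (expr_code d pc e)) (pc + size (expr_code d pc e)) s m'
            & m' (hidden d) = Posz (ev s e).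
Proof.
elim: e d pc m => [n|a e IH|o e1 IH1 e2 IH2] d pc m /=.
- case/code_at_cons=> P0 _ ms _; exists (update m (hidden d) n); last exact: update_same.
  by rewrite addn1; apply: effect_hidden P0 _ _ ms.
- case/code_at_cat=> P0 /code_at_cat [P1 /code_at_cons [P2 _]] ms se.
  have [m1 E1 v1] := IH _ _ _ P0 ms se; have [_ ms1 _] := E1.
  have [m2 E2 v2] := address_code_correct P1 ms1 v1; have [_ ms2 _] := E2.
  exists (update m2 (hidden d) (s a (ev s e))); last exact: update_same.
  rewrite !size_cat /= !addnA; apply: effect_trans (effect_trans E1 E2) _.
  by apply: (effect_hidden _ P2) => //; rewrite /= v2 ms2 addn1.
- case/code_at_cat=> P0 /code_at_cat [P1 P2] ms [se1 se2 sm].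
  have [m1 E1 v1] := IH1 _ _ _ P0 ms se1; have [_ ms1 _] := E1.
  have [m2 E2 v2] := IH2 _ _ _ P1 ms1 se2; have [_ ms2 h2] := E2.
  have v1' : m2 (hidden d) = ev s e1 by rewrite h2.
  have [|m3 E3 v3] := op_code_correct P2 ms2 v1' v2; first by case: o sm {P2}.
  exists m3 => //; rewrite !size_cat !addnA.
  exact: effect_trans (effect_trans E1 (effectW (leqnSn d) (leqnn _) E2)) E3.
Qed.

Fixpoint expr_size (e : expr) : nat :=
  match e with
  | Num _ => 1
  | Ld _ e => expr_size e + 3
  | Op _ e1 e2 => expr_size e1 + expr_size e2 + 3
  end.

Lemma size_address_code a d : size (address_code a d) <= 2.
Proof. by rewrite /address_code; case: ifP. Qed.

Lemma size_expr_code e d pc : size (expr_code d pc e) <= expr_size e.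
Proof.
elim: e d pc => //= [a e IH|o e1 IH1 e2 IH2] d pc; rewrite !size_cat /=.
  by have := IH d pc; have := size_address_code a d; lia.
set x := size _; set y := size (expr_code d.+1 _ _).
have : x <= expr_size e1 := IH1 _ _; have : y <= expr_size e2 := IH2 _ _.
by case: o => /=; lia.
Qed.

(** A polynomial in [n], of degree the nesting depth of the loops. *)
Fixpoint steps (n : nat) (c : cmd) : nat :=
  match c with
  | Asg _ e1 e2 => expr_size e1 + expr_size e2 + 3
  | Seq c1 c2 => steps n c1 + steps n c2
  | If e c1 c2 => expr_size e + steps n c1 + steps n c2 + 2
  | For _ e c => expr_size e + n * (steps n c + 5) + 4
  end.

Lemma cmd_code_correct P c d pc s m : code_at P pc (cmd_code d pc c) -> represents s m ->
  safe c s ->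
  exists m', effect P d pc m (steps S c) (pc + size (cmd_code d pc c)) (run c s) m'.
Proof.
elim: c d pc s m => [a e1 e2|c1 IH1 c2 IH2|e c1 IH1 c2 IH2|i e c IH] d pc s m /=.
- case/code_at_cat=> P0 /code_at_cat [P1 /code_at_cat [P2 /code_at_cons [P3 _]]] ms [s1 s2].
  have [m1 E1 v1] := expr_code_correct P0 ms s1; have [_ ms1 _] := E1.
  have [m2 E2 v2] := address_code_correct P1 ms1 v1; have [_ ms2 _] := E2.
  have [m3 E3 v3] := expr_code_correct P2 ms2 s2; have [_ ms3 h3] := E3.
  exists (update m3 (addr a (ev s e1)) (ev s e2)).
  have Ez : effect P d pc m (expr_size e1 + expr_size e2 + 2) (pc + size (expr_code d pc e1) +
      size (address_code a d) + size (expr_code d.+1 (pc + size (expr_code d pc e1) + size (address_code a d)) e2)) s m3.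
    apply: effectW (effect_trans (effect_trans E1 E2) (effectW (leqnSn d) (leqnn _) E3)) => //.
    set x := size (expr_code d pc _); set y := size (expr_code d.+1 _ _); set z := size _.
    have : x <= expr_size e1 := size_expr_code _ _ _; have : y <= expr_size e2 := size_expr_code _ _ _.
    by have : z <= 2 := size_address_code _ _; lia.
  set pc3 := pc + _ + _ + _ in P3 Ez.
  have E4 : effect P d pc3 m3 1 pc3.+1 (upd s a (ev s e1) (ev s e2))
      (update m3 (addr a (ev s e1)) (ev s e2)).
    split; [exists 1 => // | exact: represents_upd | exact: hidden_below_addr].
    by apply: (runs_one P3) => //=; rewrite v3 h3 ?v2 //.
  have := effect_trans Ez E4; rewrite (_ : pc + size _ = pc3.+1); last by rewrite /pc3 !size_cat /=; lia.
  by apply: effectW => //; lia.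
- case/code_at_cat=> P1 P2 ms [s1 s2].
  have [m1 E1] := IH1 _ _ _ _ P1 ms s1; have [_ ms1 _] := E1.
  have [m2 E2] := IH2 _ _ _ _ P2 ms1 s2.
  by exists m2; rewrite size_cat addnA; apply: effect_trans E1 E2.
- case/code_at_cat=> P0 /code_at_cons [P1 /code_at_cat [P2 /code_at_cons [P3 P4]]] ms [se sc].
  have [m0 E0 v0] := expr_code_correct P0 ms se; have [_ ms0 _] := E0.
  have le_e := size_expr_code e d pc.
  set p0 := size (expr_code d pc e) in P1 P2 P3 P4 E0 le_e *.
  rewrite size_cat /= size_cat /= -/p0.
  set p2 := cmd_code d _ c2 in P2 P3 P4 *; set p1 := cmd_code d _ c1 in P3 P4 *.
  case: ifP sc => ve sc.
    have [m1 E1] := IH1 _ _ _ _ P4 ms0 sc; exists m1.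
    have J : effect P d (pc + p0) m0 1 ((pc + p0).+1 + size p2).+1 s m0.
      by apply: (effect_jump d P1) => //=; rewrite v0 ltz_nat ve.
    have := effect_trans (effect_trans E0 J) E1; rewrite -/p1.
    have -> : ((pc + p0).+1 + size p2).+1 + size p1 = pc + (p0 + (size p2 + (size p1).+1).+1) by lia.
    by apply: effectW => //; lia.
  have J : effect P d (pc + p0) m0 1 (pc + p0).+1 s m0.
    by apply: (effect_jump d P1) => //=; rewrite v0 ltz_nat ve.
  have [m1 E1] := IH2 _ _ _ _ P2 ms0 sc; have [_ ms1 _] := E1; exists m1.
  have J2 := effect_jump d P3 isT erefl ms1.
  have := effect_trans (effect_trans E0 J) (effect_trans E1 J2).
  have -> : ((pc + p0).+1 + size p2).+1 + size p1 = pc + (p0 + (size p2 + (size p1).+1).+1) by lia.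
  by apply: effectW => //; lia.
- case/code_at_cat=> P0 /code_at_cons [P1 /code_at_cons [P2 /code_at_cons [P3
    /code_at_cons [P4 /code_at_cons [P5 /code_at_cat [P6 /code_at_cons [P7 /code_at_cons [P8 _]]]]]]]] ms [se sS sc].
  have [m0 E0 v0] := expr_code_correct P0 ms se; have [_ ms0 _] := E0.
  have le_e := size_expr_code e d.+1 pc.
  set p0 := size (expr_code d.+1 pc e) in P1 P2 P3 P4 P5 P6 P7 P8 E0 le_e *.
  set l := (pc + p0).+1 in P2 P3 P4 P5 P6 P7 P8 *.
  rewrite size_cat /= size_cat /= -/p0 -/l.
  set b := cmd_code d.+2 _ c in P4 P6 P7 P8 *.
  set N := ev s e in v0 sS sc *; set body := fun (k : nat) (s : store) => _ in sc *.
  have E1 := effect_hidden (leqnn d) P1 isT erefl ms0; set m1 := update m0 _ _ in E1.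
  have E01 : effect P d pc m (expr_size e + 1) l s m1.
    by apply: effectW (effect_trans (effectW (leqnSn d) (leqnn _) E0) E1) => //; lia.
  have d1d : (hidden d.+1 == hidden d) = false by apply/eqP => /hidden_inj; lia.
  have m1d : m1 (hidden d) = 0%N by rewrite /m1 update_same.
  have m1d1 : m1 (hidden d.+1) = N by rewrite /m1 /update d1d.
  (* Induction on the number [r] of remaining iterations. *)
  have loop : forall r k m, r + k = N -> represents (iteri k body s) m ->
      m (hidden d) = k -> m (hidden d.+1) = N ->
      exists m', effect P d l m (r * (steps S c + 5) + 3) (l.+4 + size b).+2 (iteri N body s) m'.
    elim=> [|r IHr] k mk rk mks kd kd1.
      have E2 := effect_hidden (leqW (leqW (leqnn d))) P2 isT erefl mks.
      set m2 := update mk _ _ in E2; have [_ ms2 h2] := E2.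
      have m2d : m2 (hidden d.+2) = (Posz N - Posz k)%R by rewrite /m2 update_same /= kd kd1.
      have J1 : effect P d l.+1 m2 1 l.+2 (iteri k body s) m2.
        apply: (effect_jump d P3) => //=; rewrite m2d.
        by have -> : (0 < Posz N - Posz k)%R = false by lia.
      have J2 := effect_jump d P4 isT erefl ms2.
      have kN : k = N by lia.
      exists m2; rewrite -kN; apply: effectW (effect_trans E2 (effect_trans J1 J2)) => //; lia.
    have E2 := effect_hidden (leqnSn d.+1) P2 isT erefl mks.
    set m2 := update mk _ _ in E2; have [_ ms2 h2] := E2.
    have m2d2 : m2 (hidden d.+2) = (Posz N - Posz k)%R by rewrite /m2 update_same /= kd kd1.
    have m2d : m2 (hidden d) = k by rewrite h2.
    have m2d1 : m2 (hidden d.+1) = N.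
      by rewrite /m2 /update; case: eqP => [/hidden_inj|_]; [lia | rewrite kd1].
    have J1 : effect P d l.+1 m2 1 l.+3 (iteri k body s) m2.
      apply: (effect_jump d P3) => //=; rewrite m2d2.
      by have -> : (0 < Posz N - Posz k)%R by lia.
    set m3 := update m2 (addr i 0) k; set s3 := upd (iteri k body s) i 0 k.
    have E3 : effect P d l.+3 m2 1 l.+4 s3 m3.
      split; [exists 1 => // | exact: represents_upd | exact: hidden_below_addr].
      by apply: (runs_one P5) => //=; rewrite m2d.
    have [_ ms3 h3] := E3.
    have [|m4 E4] := IH _ _ _ _ P6 ms3; first by apply: sc; lia.
    have [_ ms4 h4] := E4.
    have m3E j : m3 (hidden j) = m2 (hidden j) by exact: (@hidden_below_addr j.+1 m2 i 0 k j (ltnSn j)).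
    have m4d : m4 (hidden d) = k by rewrite h4 // m3E.
    have m4d1 : m4 (hidden d.+1) = N by rewrite h4 // m3E.
    have E5 := effect_hidden (leqnn d) P7 isT erefl ms4; have [_ ms5 _] := E5.
    set m5 := update m4 _ _ in E5 ms5.
    have J6 := effect_jump d P8 isT erefl ms5.
    have m5d : m5 (hidden d) = k.+1 by rewrite /m5 update_same /= m4d; lia.
    have m5d1 : m5 (hidden d.+1) = N by rewrite /m5 /update d1d.
    have [|m' E'] := IHr k.+1 m5 _ ms5 m5d m5d1; first by lia.
    exists m'; have d2 : d <= d.+2 by lia.
    have := effect_trans (effect_trans (effect_trans (effectW (leqnSn d) (leqnn _) E2) J1)
      (effect_trans E3 (effectW d2 (leqnn _) E4))) (effect_trans (effect_trans E5 J6) E').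
    by apply: effectW => //; lia.
  have [_ ms1 _] := E01; have [m' E'] := loop N 0 m1 (addn0 N) ms1 m1d m1d1.
  exists m'; have := effect_trans E01 E'.
  have -> : (l.+4 + size b).+2 = pc + (p0 + (size b + 2).+1.+4) by rewrite /l; lia.
  have := leq_mul sS (leqnn (steps S c + 5)).
  by move=> le_N; apply: effectW => //; lia.
Qed.

Definition poly_bounded (f : nat -> nat) : Prop :=
  exists b k : nat, forall n, f n <= b * n ^ k + b.

Lemma poly_bounded_cst c : poly_bounded (fun=> c).
Proof. by exists c, 0 => n; lia. Qed.

Lemma poly_bounded_id : poly_bounded id.
Proof. by exists 1, 1 => n; lia. Qed.

Lemma leq_expS k j n : n ^ k <= n ^ (k + j) + 1.
Proof.
case: n => [|n]; first by apply: leq_trans (leq_addl _ _); case: k => [|k] //; rewrite exp0n.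
by rewrite expnD; have := expn_gt0 n.+1 j; nia.
Qed.

Lemma poly_bounded_add f g : poly_bounded f -> poly_bounded g ->
  poly_bounded (fun n => f n + g n).
Proof.
move=> [b [k H]] [c [l K]]; exists (2 * (b + c)), (k + l) => n.
have := H n; have := K n; have := leq_expS k l n; have := leq_expS l k n.
rewrite [l + k]addnC; move: (n ^ k) (n ^ l) (n ^ (k + l)) (f n) (g n) => x y z u v.
nia.
Qed.

Lemma poly_bounded_mul f g : poly_bounded f -> poly_bounded g ->
  poly_bounded (fun n => f n * g n).
Proof.
move=> [b [k H]] [c [l K]]; exists (4 * (b * c)), (k + l) => n.
apply: leq_trans (leq_mul (H n) (K n)) _.
have := leq_expS k l n; have := leq_expS l k n; have := expnD n k l.
rewrite [l + k]addnC; move: (n ^ k) (n ^ l) (n ^ (k + l)) => x y z -> xy yx.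
have : (x + 1) * (y + 1) <= 4 * (x * y + 1) by nia.
nia.
Qed.

End Language.

Lemma poly_bounded_steps S c : poly_bounded S -> poly_bounded (fun n => steps (S n) c).
Proof.
move=> pS; elim: c => [a e1 e2|c1 IH1 c2 IH2|e c1 IH1 c2 IH2|i e c IH] /=;
  by do ?[exact: IH | exact: IH1 | exact: IH2 | exact: pS | exact: poly_bounded_cst
    | apply: poly_bounded_add | apply: poly_bounded_mul].
Qed.

Section CompiledProgram.
Local Open Scope nat_scope.

Definition word_store (w : seq int) : store :=
  fun a i => if code a == 0 then `|(w`_i)%R|%N else 0.

Lemma lt_expn_bitlen (z : int) : `|z|%N < 2 ^ bitlen z.
Proof. exact: trunc_log_ltn. Qed.

Lemma lt_expn_word_size (w : seq int) i : `|(w`_i)%R|%N < 2 ^ word_size w.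
Proof.
rewrite /word_size; elim: w i => [|z w IH] [|i]; rewrite ?nth_nil /= ?absz0 ?expn_gt0 //.
  rewrite big_cons; apply: leq_trans (lt_expn_bitlen z) _.
  by rewrite leq_exp2l //; lia.
rewrite big_cons; apply: leq_trans (IH i) _.
by rewrite leq_exp2l //; lia.
Qed.

Lemma literals_fit_bitlen c : literals_fit (\sum_(z <- instr_literals c) bitlen z) c.
Proof.
apply/(all_nthP 0%R) => i _.
exact: lt_expn_word_size.
Qed.

Lemma literals_fit_sum (p : program) :
  all (literals_fit (\sum_(c <- p) \sum_(z <- instr_literals c) bitlen z)) p.
Proof.
elim: p => //= c p IH; rewrite big_cons.
set x := \sum_(z <- _) _; set y := \sum_(z <- p) _ in IH *.
apply/andP; split; last by apply: sub_all IH => z; apply: literals_fit_le; lia.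
by apply: (@literals_fit_le x); [lia | apply: literals_fit_bitlen].
Qed.

(** For a fixed command the number of steps is a polynomial in the loop bound,
    and each step is tame, so the logarithmic cost is polynomial as well. *)
Theorem compiled_polynomially_solvable (I : Type) (encode : I -> seq int)
    (valid : I -> Prop) (solution : I -> seq int -> Prop) (c : cmd) (S : nat -> nat) :
  poly_bounded S ->
  (forall x, valid x ->
     [/\ all (fun z : int => (0 <= z)%R) (encode x),
         safe (S (word_size (encode x))) (word_size (encode x) + 6) c (word_store (encode x))
       & exists2 w, solution x w & forall i, i < size w ->
           Posz (run c (word_store (encode x)) IO i) = (w`_i)%R]) ->
  polynomially_solvable encode valid solution.
Proof.
move=> pS H; set P := cmd_code 0 0 c.
pose lit : nat := \sum_(ins <- P) \sum_(z <- instr_literals ins) bitlen z.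
have fitP : all (literals_fit lit) P := literals_fit_sum P.
have [b [k Hb]] : poly_bounded (fun W =>
    steps (S W) c * (8 * (((W + lit) + steps (S W) c * (W + 6)) + 1))).
  by do ?[exact: poly_bounded_id | exact: (poly_bounded_steps c pS) | exact: poly_bounded_cst
    | apply: poly_bounded_add | apply: poly_bounded_mul].
exists P, b, k => x /H [posx sx [w solw Hw]].
set W := word_size (encode x) in Hb sx *.
have rep0 : represents (word_store (encode x)) (input_memory (encode x)).
  move=> a i; rewrite /addr /word_store /input_memory; case: eqP => [_|ca].
    rewrite gez0_abs //; case: (ltnP i (size (encode x))) => iw; last by rewrite nth_default.
    exact: (all_nthP 0%R posx).
  by case E: (- _)%R => [n|n] //; exfalso; lia.
have fit0 : fits (W + lit) (input_memory (encode x)).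
  move=> [i|i] /=; last by rewrite expn_gt0.
  apply: leq_trans (_ : 2 ^ W <= _); last by rewrite leq_exp2l //; lia.
  exact: lt_expn_word_size.
have P0 : code_at P 0 (cmd_code 0 0 c) by [].
have G5 : 5 < W + 6 by lia.
have [m' [[n le_n r] ms' _]] := cmd_code_correct G5 P0 rep0 sx.
have [||t ext le_t] := runs_exec _ _ fit0 r (leqnn _); first by lia.
  by apply: sub_all fitP => z; apply: literals_fit_le; lia.
exists t, m', w; split=> //; first last.
  by move=> i iw; rewrite -Hw // -ms' /addr.
apply: leq_trans le_t _; apply: leq_trans (Hb _).
apply: leq_mul => //; rewrite leq_mul2l /= addn1 ltnS leq_add2l.
by rewrite leq_mul2r le_n orbT.
Qed.

End CompiledProgram.

(** * Relaxation of difference constraints *)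

Section Relaxation.
Local Open Scope nat_scope.
Variables (E : nat) (ex ey inc dec : nat -> nat).

(** The potential that an edge proposes for its head. Truncation at zero is
    harmless because potentials are nonnegative. *)
Definition gain (J : nat -> nat) (e : nat) : nat := J (ex e) + inc e - dec e.

Definition closed_potential (J : nat -> nat) : Prop :=
  forall e, e < E -> gain J e <= J (ey e).

Variable R : realDomainType.

(** Solutions of the untruncated constraints in an ordered ring: the existence
    of one excludes cycles of positive gain. *)
Definition feasible (phi : nat -> R) : Prop :=
  forall e, e < E -> (phi (ex e) + (inc e)%:R - (dec e)%:R <= phi (ey e))%R.

Definition dominates (J : nat -> nat) (phi : nat -> R) : Prop :=
  forall y, ((J y)%:R <= phi y)%R.

Lemma gain_le J phi e : e < E -> feasible phi -> dominates J phi ->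
  ((gain J e)%:R <= phi (ey e))%R.
Proof.
move=> eE fphi Jphi.
case: (leqP (J (ex e) + inc e) (dec e)) => h.
  rewrite /gain (eqP h); apply: le_trans (Jphi (ey e)); exact: ler0n.
rewrite /gain natrB ?natrD; last exact: ltnW.
by apply: le_trans (fphi e eE); rewrite lerD2r lerD2r Jphi.
Qed.

Variable P0 : nat -> nat.

Definition relax_all (J : nat -> nat) (y : nat) : nat :=
  maxn (J y) (\max_(e < E | ey e == y) gain J e).

Definition relaxed (k : nat) : nat -> nat := iter k relax_all P0.

Lemma relaxed_mono k y : relaxed k y <= relaxed k.+1 y.
Proof. exact: leq_maxl. Qed.

Lemma relaxed_le k l y : k <= l -> relaxed k y <= relaxed l y.
Proof.
move/subnK <-; elim: (l - k) => // d IH.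
exact: leq_trans IH (relaxed_mono _ _).
Qed.

Lemma relaxed_gain k e : e < E -> gain (relaxed k) e <= relaxed k.+1 (ey e).
Proof.
move=> eE; rewrite /= /relax_all leq_max; apply/orP; right.
exact: (@leq_bigmax_cond _ (fun i : 'I_E => ey i == ey e) (fun i => gain (relaxed k) i) (Ordinal eE)).
Qed.

Lemma relaxed_grows k y : relaxed k y < relaxed k.+1 y ->
  exists e, [/\ e < E, ey e = y & relaxed k.+1 y = gain (relaxed k) e].
Proof.
rewrite /= -/(relaxed k) /relax_all => lt.
have lt' : relaxed k y < \max_(e < E | ey e == y) gain (relaxed k) e by lia.
have [i iy iE] : exists2 i : 'I_E, ey i == y & \max_(e < E | ey e == y) gain (relaxed k) e = gain (relaxed k) i.
  case: (posnP #|[pred i : 'I_E | ey i == y]|) => [/card0_eq c0|/card_gt0P [i iy]].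
    by move: lt'; rewrite big_pred0.
  have [j jy jE] := @eq_bigmax_cond _ [pred i : 'I_E | ey i == y] (fun i => gain (relaxed k) i) (introT card_gt0P (ex_intro _ i iy)).
  by exists j; [exact: jy | rewrite -jE].
by exists i; split=> //; [exact/eqP | lia].
Qed.

Lemma relaxed_dominated k phi : feasible phi -> dominates P0 phi -> dominates (relaxed k) phi.
Proof.
move=> fphi P0phi; elim: k => // k IH y.
case: (ltnP (relaxed k y) (relaxed k.+1 y)) => [/relaxed_grows [e [eE <- ->]]|le].
  exact: gain_le.
by apply: le_trans (IH y); rewrite ler_nat.
Qed.

(** A value that was raised has an edge to account for it, since the tails of
    edges never decrease. *)
Lemma relaxed_tight k y : relaxed k y = P0 y \/
  exists e, [/\ e < E, ey e = y & relaxed k y <= gain (relaxed k) e].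
Proof.
elim: k => [|k IH]; first by left.
case: (ltnP (relaxed k y) (relaxed k.+1 y)) => [/relaxed_grows [e [eE ey_ ->]]|le].
  by right; exists e; split=> //; have := relaxed_mono k (ex e); rewrite /gain; lia.
have -> : relaxed k.+1 y = relaxed k y by have := relaxed_mono k y; lia.
case: IH => [|[e [eE ey_ le']]]; [by left | right; exists e; split=> //].
by have := relaxed_mono k (ex e); move: le'; rewrite /gain; lia.
Qed.

Definition active (k e : nat) : bool := relaxed k (ey e) < gain (relaxed k) e.

Lemma active_pred k e : active k.+1 e -> e < E ->
  exists e', [/\ e' < E, ey e' = ex e, active k e' & relaxed k.+1 (ex e) = gain (relaxed k) e'].
Proof.
move=> ae eE; have lt : relaxed k (ex e) < relaxed k.+1 (ex e).
  rewrite ltnNge; apply/negP => le; move: ae; rewrite /active ltnNge => /negP; apply.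
  by apply: leq_trans (relaxed_gain k eE); rewrite /gain; lia.
have [e' [e'E e'y e'g]] := relaxed_grows lt.
by exists e'; split=> //; rewrite /active e'y -e'g.
Qed.

(** Read backwards, an edge still active in round [k] comes with a chain of
    edges, one active in each earlier round, whose gains add up along a walk. *)
Lemma active_chain k e : active k e -> e < E ->
  exists f : nat -> nat, [/\ f k = e, forall i, i <= k -> f i < E /\ active i (f i)
    & forall i, i < k -> ey (f i) = ex (f i.+1) /\
        relaxed i.+1 (ey (f i)) = gain (relaxed i) (f i)].
Proof.
elim: k e => [|k IH] e ae eE.
  by exists (fun=> e); split=> // i; rewrite leqn0 => /eqP ->.
have [e' [e'E e'y ae' g]] := active_pred ae eE.
have [f [fk fa fc]] := IH e' ae' e'E.
exists (fun i => if i == k.+1 then e else f i); split; first by rewrite eqxx.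
  by move=> i ik; case: eqP => [->|ne] //; apply: fa; lia.
move=> i ik; have -> : (i == k.+1) = false by apply/eqP; lia.
rewrite eqSS; case: eqP => [->|ne]; last by apply: fc; lia.
by rewrite fk e'y.
Qed.

(** Along such a chain the slack [phi - P] does not decrease. A chain through
    [E + 1] rounds uses an edge twice, and then its second use cannot be active:
    so [E] rounds reach a fixpoint. *)
Lemma relaxed_closed phi : feasible phi -> dominates P0 phi -> closed_potential (relaxed E).
Proof.
move=> fphi P0phi e eE; rewrite leqNgt; apply/negP => /active_chain /(_ eE) [f [_ fa fc]].
have slack i j : i <= j -> j <= E ->
    (phi (ex (f i)) - (relaxed i (ex (f i)))%:R <= phi (ex (f j)) - (relaxed j (ex (f j)))%:R)%R.
  move/subnK <-; elim: (j - i) => // d IH dE; apply: le_trans (IH _) _; first by lia.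
  rewrite addSn; set k := d + i in dE *.
  have [fkE fka] := fa k (ltnW dE); have [<- ->] := fc k dE.
  have lt0 : dec (f k) < relaxed k (ex (f k)) + inc (f k).
    by move: fka; rewrite /active /gain; lia.
  rewrite /gain natrB ?natrD; last exact: ltnW.
  have := fphi _ fkE; rewrite -!lerBlDr => H; rewrite -subr_ge0; move: H; rewrite -subr_ge0.
  by congr (0 <= _)%R; ring.
have [i [j [ij jE fij]]] : exists i j : nat, [/\ i < j, j <= E & f i = f j].
  have : ~~ injectiveb (fun i : 'I_E.+1 => inord (f i) : 'I_E.-1.+1).
    apply/negP => /injectiveP /leq_card; rewrite !card_ord.
    by case: (E) eE => // n _; rewrite ltnn.
  case/injectivePn => i [j ne]; case: (fa i (ltn_ord i)) => fi _; case: (fa j (ltn_ord j)) => fj _.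
  have E0 : E.-1.+1 = E by lia.
  move/(congr1 val) => /=; rewrite !inordK ?E0 // => fij.
  case: (ltngtP i j) => [lt|lt|/val_inj eq]; last by rewrite eq eqxx in ne.
    by exists i, j; split=> //; rewrite -ltnS ltn_ord.
  by exists j, i; split=> //; rewrite -ltnS ltn_ord.
have iE : i <= E by lia.
have [fiE _] := fa i iE; have [fjE fja] := fa j jE.
have := slack i j (ltnW ij) jE; rewrite fij lerD2l lerN2 ler_nat => le.
have := relaxed_gain i fiE; have := relaxed_le (ey (f j)) ij.
by move: fja; rewrite /active fij /gain; lia.
Qed.

End Relaxation.

(** * Reasoning about loop programs *)

Section Logic.
Local Open Scope nat_scope.
Variables S G : nat.

Definition wp (c : cmd) (Q : store -> Prop) (s : store) : Prop :=
  safe S G c s /\ Q (run c s).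

Fixpoint writes (c : cmd) (b : array) : bool :=
  match c with
  | Asg a _ _ => code b == code a
  | Seq c1 c2 => writes c1 b || writes c2 b
  | If _ c1 c2 => writes c1 b || writes c2 b
  | For i _ c => (code b == code i) || writes c b
  end.

Definition frame (c : cmd) (s s' : store) : Prop := forall a, ~~ writes c a -> s' a = s a.

Lemma frame_run c s : frame c s (run c s).
Proof.
elim: c s => [a e1 e2|c1 IH1 c2 IH2|e c1 IH1 c2 IH2|i e c IH] s b /=.
- by rewrite /upd; case: eqP.
- by rewrite negb_or => /andP[w1 w2]; rewrite IH2 ?IH1.
- by rewrite negb_or => /andP[w1 w2]; case: ifP => _; rewrite ?IH2 ?IH1.
- rewrite negb_or => /andP[/negPf wi wc]; elim: (ev s e) => //= n IHn.
  by rewrite IH // /upd wi.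
Qed.

Lemma wp_seq c1 c2 Q s : wp c1 (wp c2 Q) s -> wp (Seq c1 c2) Q s.
Proof. by case=> s1 [s2 q]. Qed.

Lemma wp_asg a e1 e2 (Q : store -> Prop) s : safe_expr G s e1 -> safe_expr G s e2 ->
  Q (upd s a (ev s e1) (ev s e2)) -> wp (Asg a e1 e2) Q s.
Proof. by []. Qed.

Lemma wp_if e c1 c2 Q s : safe_expr G s e ->
  (0 < ev s e -> wp c1 Q s) -> (ev s e = 0 -> wp c2 Q s) -> wp (If e c1 c2) Q s.
Proof.
rewrite /wp /= => se; case: (posnP (ev s e)) => [e0 _ /(_ e0) []|e0 /(_ isT) []] //.
Qed.

Lemma wp_conseq c (Q1 Q : store -> Prop) s : wp c Q1 s ->
  (forall s', frame c s s' -> Q1 s' -> Q s') -> wp c Q s.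
Proof. by case=> sc q1 H; split=> //; apply: H => //; apply: frame_run. Qed.

(** The body may rely on everything that the loop does not write, so that
    invariants need only speak of what it writes. *)
Lemma wp_for i e c (I : nat -> store -> Prop) s : safe_expr G s e -> ev s e <= S -> I 0 s ->
  (forall k s', k < ev s e -> frame (For i e c) s s' -> I k s' -> wp c (I k.+1) (upd s' i 0 k)) ->
  wp (For i e c) (I (ev s e)) s.
Proof.
move=> se eS I0 step; rewrite /wp /=.
set body := fun (k : nat) (s : store) => run c (upd s i 0 k).
have fr k : frame (For i e c) s (iteri k body s).
  have := @frame_run (For i (Num k) c) s; rewrite /frame /=; exact.
have inv k : k <= ev s e -> I k (iteri k body s).
  elim: k => // k IH lt; have [_] := step k _ lt (fr k) (IH (ltnW lt)); exact.
split; last exact: inv.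
split=> // k lt; have [] := step k _ lt (fr k) (inv k (ltnW lt)); exact.
Qed.

End Logic.

Arguments upd s a i v b /.

Declare Scope prog_scope.
Delimit Scope prog_scope with P.
Bind Scope prog_scope with expr.
Bind Scope prog_scope with cmd.

Notation "$ a" := (Ld a (Num 0)) (at level 2, a at level 1, format "$ a") : prog_scope.
Notation "# n" := (Num n) (at level 2, n at level 1, format "# n") : prog_scope.
Notation "a @[ e ]" := (Ld a e) (at level 2, format "a @[ e ]") : prog_scope.
Notation "x + y" := (Op Add x y) : prog_scope.
Notation "x - y" := (Op Sub x y) : prog_scope.
Notation "x * y" := (Op Mul x y) : prog_scope.
Notation "x / y" := (Op Div x y) : prog_scope.
Notation "a ::= e" := (Asg a (Num 0) e) (at level 70) : prog_scope.
Notation "a @@ i ::= e" := (Asg a i e) (at level 70, i at level 50) : prog_scope.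
Notation "c1 ;; c2" := (Seq c1 c2) (at level 85, right associativity) : prog_scope.

Section Programs.
Local Open Scope nat_scope.

Definition emax (x y : expr) : expr := (x + (y - x))%P.
Definition emin (x y : expr) : expr := (x - (x - y))%P.
Definition edist (x y : expr) : expr := ((x - y) + (y - x))%P.
Definition skip : cmd := (Idx ::= #0)%P.

(** In-place relaxation reaches the fixpoint at least as fast as simultaneous
    rounds, and cannot overshoot it. *)
Definition relax_prog : cmd := (
  For Round $NumEdges (For Edge $NumEdges (
    Pot @@ (Into@[$Edge]) ::= emax Pot@[Into@[$Edge]]
                                (Pot@[From@[$Edge]] + Inc@[$Edge] - Dec@[$Edge]))))%P.

(** Between consecutive end points the step function is constant: [Cur] jumps
    from one to the next, and [Area] grows by one rectangle at a time. *)
Definition sweep_prog : cmd := (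
  Cur ::= #0;; Area ::= #0;;
  For Round $NumNodes (
    Next ::= Val@[$NumNodes - #1];; Cdf ::= #0;;
    For Edge $NumNodes (
      If ($Cur + #1 - Val@[$Edge]) (Cdf ::= emax $Cdf Pot@[$Edge])
         (Next ::= emin $Next Val@[$Edge]));;
    Area ::= $Area + ($Next - $Cur) * $Cdf;;
    Cur ::= $Next))%P.

(** Arc data have variable length, three words and eight per constraint, so
    their positions are recorded in a first pass. *)
Definition scan_prog : cmd := (
  Narcs ::= IO@[#1];; Src ::= IO@[#2];; Dst ::= IO@[#3];;
  Den ::= #1;; Ptr ::= #4;;
  For Arc $Narcs (
    Off @@ $Arc ::= $Ptr;;
    For Idx (IO@[$Ptr + #2] * #4) (Den ::= $Den * IO@[$Ptr + #4 + $Idx * #2]);;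
    Ptr ::= $Ptr + #3 + IO@[$Ptr + #2] * #8))%P.

Definition load_prog : cmd := (
  Base ::= Off@[$Arc];; Cons ::= IO@[$Base + #2];;
  For Idx ($Cons * #4) (
    Scaled @@ $Idx ::= $Den / IO@[$Base + #4 + $Idx * #2] * IO@[$Base + #3 + $Idx * #2]);;
  For Idx $Cons (
    Val @@ $Idx ::= Scaled@[$Idx * #4];;
    Val @@ ($Cons + $Idx) ::= Scaled@[$Idx * #4 + #1]);;
  NumNodes ::= $Cons + $Cons;;
  NumEdges ::= $NumNodes * $NumNodes)%P.

(** Monotonicity is imposed by one edge per pair of end points; for a pair in the
    wrong order the decrement is at least [D], which makes the edge void. Two
    more edges per constraint bound the increase over its interval. *)
Definition edges_prog : cmd := (
  For Idx $NumEdges (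
    From @@ $Idx ::= $Idx / $NumNodes;;
    Into @@ $Idx ::= $Idx - $Idx / $NumNodes * $NumNodes;;
    Inc @@ $Idx ::= #0;;
    Dec @@ $Idx ::= (Val@[From@[$Idx]] - Val@[Into@[$Idx]]) * $Den);;
  For Idx $NumNodes (
    From @@ ($NumEdges + $Idx) ::= $Idx;;
    If ($Cons - $Idx) (
      Into @@ ($NumEdges + $Idx) ::= $Cons + $Idx;;
      Inc @@ ($NumEdges + $Idx) ::= Scaled@[$Idx * #4 + #2];;
      Dec @@ ($NumEdges + $Idx) ::= #0)
    (
      Into @@ ($NumEdges + $Idx) ::= $Idx - $Cons;;
      Inc @@ ($NumEdges + $Idx) ::= #0;;
      Dec @@ ($NumEdges + $Idx) ::= Scaled@[($Idx - $Cons) * #4 + #3]));;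
  NumEdges ::= $NumEdges + $NumNodes)%P.

Definition price_prog : cmd := (
  Big ::= #1;;
  For Arc $Narcs (
    load_prog;; edges_prog;; relax_prog;; sweep_prog;;
    Price @@ $Arc ::= (Val@[$NumNodes - #1] * $Den - $Area) * ($Narcs + #1) + #1;;
    Big ::= $Big + Price@[$Arc];;
    For Idx $NumNodes (Pot @@ $Idx ::= #0)))%P.

(** Edges run against the arcs: the potential of the head of an arc, less its
    price, is a lower bound for that of its tail. *)
Definition route_prog : cmd := (
  For Arc $Narcs (
    From @@ $Arc ::= IO@[Off@[$Arc] + #1];; Into @@ $Arc ::= IO@[Off@[$Arc]];;
    Inc @@ $Arc ::= #0;; Dec @@ $Arc ::= Price@[$Arc]);;
  Pot @@ $Dst ::= $Big;;
  NumEdges ::= $Narcs;;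
  relax_prog)%P.

(** Whenever a tight arc leaves the current node it is followed at once. A pass
    over all arcs follows at least one, unless the destination is reached. *)
Definition trace_prog : cmd := (
  Here ::= $Src;;
  For Round $Narcs (For Arc $Narcs (
    If (edist Into@[$Arc] $Here + edist (Pot@[$Here] + Price@[$Arc]) Pot@[From@[$Arc]])
      skip
      (Chosen @@ $Arc ::= #1;; Here ::= From@[$Arc]))))%P.

Definition output_prog : cmd := (
  IO @@ #0 ::= #1;;
  IO @@ #1 ::= ($Big - Pot@[$Src]) / ($Narcs + #1);;
  IO @@ #2 ::= $Den * $Den;;
  For Arc $Narcs (IO @@ ($Arc + #3) ::= Chosen@[$Arc]))%P.

Definition drsp_prog : cmd := (
  scan_prog;; price_prog;; route_prog;;
  If Pot@[$Src] (trace_prog;; output_prog) (IO @@ #0 ::= #0))%P.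

End Programs.

Section RelaxProgram.
Local Open Scope nat_scope.
Variables (S G : nat).

(** After [r] passes the potential lies between [r] simultaneous rounds and their
    limit. *)
Lemma relax_prog_correct E ex ey inc dec P0 (s : store) :
  s NumEdges 0 = E -> E <= S ->
  (forall e, e < E -> [/\ s From e = ex e, s Into e = ey e, s Inc e = inc e & s Dec e = dec e]) ->
  s Pot =1 P0 ->
  closed_potential E ex ey inc dec (relaxed E ex ey inc dec P0 E) ->
  wp S G relax_prog (fun s' => s' Pot =1 relaxed E ex ey inc dec P0 E) s.
Proof.
move=> sE ES edges sP; set J := relaxed E ex ey inc dec P0 => closed.
apply: (@wp_conseq _ _ _ (fun s' => forall y, J E y <= s' Pot y <= J E y)); last first.
  by move=> s' _ H y; apply/eqP; rewrite eqn_leq andbC.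
rewrite -{1}sE.
apply: (@wp_for _ _ _ _ _ (fun r s' => forall y, J r y <= s' Pot y <= J E y)) => //=; first by rewrite sE.
  by move=> y; rewrite sP leqnn; apply: (@relaxed_le E ex ey inc dec P0 0 E y).
rewrite sE => r s1 rE fr inv.
have eN := fr NumEdges isT; have eF := fr From isT; have eI := fr Into isT.
have eInc := fr Inc isT; have eDec := fr Dec isT.
apply: wp_conseq.
  apply: (@wp_for _ _ _ _ _ (fun e s' => (forall y, J r y <= s' Pot y <= J E y) /\
     forall e', e' < e -> gain ex inc dec (J r) e' <= s' Pot (ey e'))) => //=.
    by rewrite eN sE.
  rewrite eN sE => e s2 eE fr2 [inv2 gains].
  have {eN}eN := fr2 NumEdges isT; have {eF}eF := etrans (fr2 From isT) eF.
  have {eI}eI := etrans (fr2 Into isT) eI.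
  have {eInc}eInc := etrans (fr2 Inc isT) eInc; have {eDec}eDec := etrans (fr2 Dec isT) eDec.
  apply: wp_asg => //=; rewrite eF eI eInc eDec.
  have [-> -> -> ->] := edges e eE.
  set v := s2 Pot (ey e) + _.
  have vE : v = maxn (s2 Pot (ey e)) (gain ex inc dec (s2 Pot) e).
    by rewrite /v /gain; lia.
  have := closed e eE; have := inv2 (ex e); have := inv2 (ey e); rewrite /gain => i1 i2 cl.
  split=> [y|e' e'e]; case: eqP => [E1|ne] //.
  - by rewrite E1 vE /gain; lia.
  - move: e'e; rewrite ltnS leq_eqVlt => /orP [/eqP ->|/gains]; rewrite vE ?E1 /gain; lia.
  - move: e'e; rewrite ltnS leq_eqVlt => /orP [/eqP ee|/gains //].
    by case: ne; rewrite ee.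
move=> s2 fr2 [inv2 gains] y; rewrite /= eN sE in gains.
have /andP [lo hi] := inv2 y; rewrite hi andbT /relax_all geq_max lo /=.
apply/bigmax_leqP => e /eqP <-.
exact: gains.
Qed.

End RelaxProgram.

(** * Integrating a step function *)

Section Sweep.
Local Open Scope nat_scope.
Variables (S G : nat).

(** For [P] increasing along [V], this is [P] at the last end point up to [z]. *)
Definition step_cdf (N : nat) (V P : nat -> nat) (z : nat) : nat :=
  \max_(0 <= j < N | V j <= z) P j.

Lemma step_cdf_const N (V P : nat -> nat) z z' : z <= z' ->
  (forall j, j < N -> z < V j -> z' < V j) -> step_cdf N V P z' = step_cdf N V P z.
Proof.
move=> zz' H; rewrite /step_cdf big_nat_cond [RHS]big_nat_cond; apply: eq_bigl => j /=.
case: ltnP => //= jN; have := H j jN; lia.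
Qed.

Lemma bigmax_nat_recr (p : pred nat) (P : nat -> nat) e :
  \max_(0 <= j < e.+1 | p j) P j =
  if p e then maxn (\max_(0 <= j < e | p j) P j) (P e) else \max_(0 <= j < e | p j) P j.
Proof. by rewrite big_mkcond big_nat_recr //= -big_mkcond; case: ifP; rewrite ?maxn0. Qed.

(** Each pass either has reached the last end point or puts one more end point
    behind [Cur], so [N] passes suffice. *)
Lemma sweep_prog_correct N V P (s : store) :
  0 < N -> N <= S -> s NumNodes 0 = N -> (forall j, j < N -> s Val j = V j) -> s Pot =1 P ->
  (forall j, j < N -> V j <= V (N - 1)) -> (forall j, j < N -> P j < 2 ^ G) ->
  wp S G sweep_prog (fun s' => s' Area 0 = \sum_(0 <= z < V (N - 1)) step_cdf N V P z) s.
Proof.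
move=> N0 NS sN sV sP VU PG; set U := V (N - 1).
apply: wp_seq; apply: wp_asg => //=; apply: wp_seq; apply: wp_asg => //=.
(* The number of end points at or below [Cur] measures progress. *)
pose count c := \sum_(0 <= j < N) (V j <= c).
pose Inv r (s : store) := [/\ s Cur 0 <= U, s Area 0 = \sum_(0 <= z < s Cur 0) step_cdf N V P z
   & s Cur 0 = U \/ r <= count (s Cur 0)].
apply: wp_conseq.
  apply: (@wp_for _ _ _ _ _ Inv) => //=; first by rewrite sN.
    by rewrite /Inv /= big_geq; split=> //; right.
  move=> r s1 rN fr [curU areaE cnt].
  have eN := fr NumNodes isT; have eV := fr Val isT; have eP := fr Pot isT.
  rewrite /= in eN eV eP.
  apply: wp_seq; apply: wp_asg => //=; apply: wp_seq; apply: wp_asg => //=.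
  rewrite eN eV sN sV; last by lia.
  set cur := s1 Cur 0 in curU areaE cnt.
  pose I e (s : store) := [/\ s Cdf 0 = \max_(0 <= j < e | V j <= cur) P j,
    cur <= s Next 0 <= U, forall j, j < e -> cur < V j -> s Next 0 <= V j
    & s Next 0 = U \/ exists2 j, j < N & V j = s Next 0 /\ cur < V j].
  apply: wp_seq; apply: wp_conseq.
    apply: (@wp_for _ _ _ _ _ I) => //=; first by rewrite eN sN.
      by rewrite /I /= big_geq //; split=> //; [rewrite curU leqnn | left].
    rewrite eN sN => e s2 eN' fr2 [cdfE /andP [nx1 nx2] nxle nxE].
    have {}eV := etrans (fr2 Val isT) eV; have {}eP := etrans (fr2 Pot isT) eP.
    have eC : s2 Cur 0 = cur by rewrite (fr2 Cur isT).
    apply: wp_if => //=; rewrite eV eC sV //.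
      move=> le; have le_cur : V e <= cur by lia.
      apply: wp_asg => //=; rewrite eP sP; split=> //=.
      - by rewrite bigmax_nat_recr le_cur cdfE; lia.
      - by rewrite nx1.
      - by move=> j; rewrite ltnS leq_eqVlt => /orP [/eqP ->|/nxle //]; lia.
    move=> lt; have gt_cur : (V e <= cur) = false by lia.
    apply: wp_asg => //=; rewrite eV sV //; split=> //=.
    - by rewrite bigmax_nat_recr gt_cur cdfE.
    - by lia.
    - by move=> j; rewrite ltnS leq_eqVlt => /orP [/eqP ->|/nxle jn /jn]; lia.
    - case: (leqP (s2 Next 0) (V e)) => h.
        by have -> : s2 Next 0 - (s2 Next 0 - V e) = s2 Next 0 by lia.
      by right; exists e => //; lia.
  rewrite /= eN sN => s3 fr3 [cdfE /andP [nx1 nx2] nxle nxE].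
  have eC : s3 Cur 0 = cur by rewrite (fr3 Cur isT).
  have eA : s3 Area 0 = s1 Area 0 by rewrite (fr3 Area isT).
  apply: wp_seq; apply: wp_asg => //=.
    split=> //; split=> //; rewrite cdfE big_nat_cond.
    elim/big_ind: _ => [|x y|j /andP [/andP [_ jN] _]]; first by rewrite expn_gt0.
      by rewrite gtn_max => -> ->.
    exact: PG.
  apply: wp_asg => //=; rewrite /Inv /= eC eA areaE; split=> //.
    rewrite (big_cat_nat (leq0n cur) nx1) //=; congr addn.
    rewrite (eq_big_nat _ _ (F2 := fun=> step_cdf N V P cur)).
      by rewrite sum_nat_const_nat /step_cdf -cdfE; lia.
    move=> z /andP [z1 z2]; apply: step_cdf_const => // j jN lt.
    by have := nxle j jN lt; lia.
  case: (ltnP cur U) => cU; last by left; lia.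
  case: cnt => [|cnt]; first by lia.
  right; apply: leq_ltn_trans cnt _.
  have [j jN [jV jc]] : exists2 j, j < N & V j = s3 Next 0 /\ cur < V j.
    by case: nxE => // ->; exists (N - 1) => //; lia.
  rewrite /count !big_mkord (bigD1 (Ordinal jN)) //= [X in _ < X](bigD1 (Ordinal jN)) //=.
  rewrite (_ : (V j <= cur) = false); last by lia.
  rewrite (_ : V j <= s3 Next 0); last by rewrite jV.
  rewrite add0n add1n ltnS; apply: leq_sum => i _.
  by case: (leqP (V i) cur) => //= h; rewrite (leq_trans h).
rewrite /= sN => s1 fr [curU -> cnt]; suff -> : s1 Cur 0 = U by [].
case: cnt => // cnt; apply/eqP; rewrite eqn_leq curU leqNgt; apply/negP => lt.
move: cnt; rewrite leqNgt => /negP; apply.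
apply: leq_ltn_trans (_ : \sum_(0 <= j < N.-1) 1 < N).
  rewrite /count -{1}(prednK N0) big_nat_recr //= -subn1.
  rewrite [X in _ + X](_ : _ = 0); last by apply/eqP; rewrite eqb0 -ltnNge.
  by rewrite addn0; apply: leq_sum => j _; rewrite leq_b1.
by rewrite sum_nat_const_nat; lia.
Qed.

End Sweep.

(** * Loading the data of an arc *)

Section ArcData.
Local Open Scope nat_scope.

(** The data of one arc, scaled to integers: [K] subintervals with end points
    [V j], [j < K], and [V (K + j)], probability bounds [ql j] and [qu j], and
    the common denominator [D], which stands for probability one. *)
Variables (K : nat) (V ql qu : nat -> nat) (D : nat).

(** Edges number [e < (2 K) ^ 2] compare the end points [e / 2 K] and
    [e mod 2 K]; the last [2 K] edges run from left to right end points and back. *)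
Definition cdf_edges : nat := (K + K) * (K + K) + (K + K).

Definition cdf_from (e : nat) : nat :=
  if e < (K + K) * (K + K) then e %/ (K + K) else e - (K + K) * (K + K).

Definition cdf_into (e : nat) : nat :=
  let M := (K + K) * (K + K) in
  if e < M then e %% (K + K) else if e - M < K then K + (e - M) else e - M - K.

Definition cdf_inc (e : nat) : nat :=
  let M := (K + K) * (K + K) in
  if e < M then 0 else if e - M < K then ql (e - M) else 0.

Definition cdf_dec (e : nat) : nat :=
  let M := (K + K) * (K + K) in
  if e < M then (V (e %/ (K + K)) - V (e %% (K + K))) * D
  else if e - M < K then 0 else qu (e - M - K).

Definition cdf_pot : nat -> nat :=
  relaxed cdf_edges cdf_from cdf_into cdf_inc cdf_dec (fun=> 0) cdf_edges.

Definition arc_cost : nat :=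
  V (K + K - 1) * D - \sum_(0 <= z < V (K + K - 1)) step_cdf (K + K) V cdf_pot z.

Hypothesis K0 : 0 < K.

Lemma cdf_into_lt e : e < cdf_edges -> cdf_into e < K + K.
Proof.
rewrite /cdf_edges /cdf_into; case: ifP => [_ _|]; first by rewrite ltn_mod; lia.
by case: ifP; lia.
Qed.

Lemma cdf_pot_out j : K + K <= j -> cdf_pot j = 0.
Proof.
move=> jK; rewrite /cdf_pot; elim: {2}cdf_edges => // k IH; apply/eqP.
rewrite -leqn0 -[X in _ <= X]IH leqNgt; apply/negP => /relaxed_grows [e [eE ej _]].
by have := cdf_into_lt eE; rewrite ej; lia.
Qed.

End ArcData.

Section ArcLoading.
Local Open Scope nat_scope.
Variables (S G W A src dst : nat) (K tl hd off io : nat -> nat) (num den : nat -> nat -> nat).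

Definition denominator : nat := \prod_(0 <= a < A) \prod_(0 <= k < K a * 4) den a k.

(** All that the program needs to know of the encoded instance. The rational
    number [k] of arc [a] is [num a k / den a k], and [W] is the input size. *)
Record layout : Prop := Layout {
  layout_A : io 1 = A;
  layout_src : io 2 = src;
  layout_dst : io 3 = dst;
  layout_off0 : off 0 = 4;
  layout_offS : forall a, off a.+1 = off a + 3 + K a * 8;
  layout_tl : forall a, a < A -> io (off a) = tl a;
  layout_hd : forall a, a < A -> io (off a + 1) = hd a;
  layout_K : forall a, a < A -> io (off a + 2) = K a;
  layout_num : forall a k, a < A -> k < K a * 4 -> io (off a + 3 + k * 2) = num a k;
  layout_den : forall a k, a < A -> k < K a * 4 -> io (off a + 4 + k * 2) = den a k;
  layout_lt : forall i, io i < 2 ^ W;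
  layout_size : off A <= W;
  layout_K0 : forall a, a < A -> 0 < K a;
  layout_prod : denominator < 2 ^ W
}.

Hypothesis L : layout.
Lemma off_le a b : a <= b -> off a <= off b.
Proof.
move/subnK <-; elim: (b - a) => // d IH; rewrite addSn (layout_offS L); lia.
Qed.

Lemma arcs_small : 4 + A * 3 <= W.
Proof.
apply: leq_trans (layout_size L).
elim: {1 2}A => [|a IH]; rewrite ?(layout_off0 L) ?(layout_offS L); lia.
Qed.

Lemma K_small a : a < A -> 8 * K a + 7 <= W.
Proof.
move=> aA; have := off_le aA; have := layout_size L; rewrite (layout_offS L).
by have := off_le (leq0n a); rewrite (layout_off0 L); lia.
Qed.

Hypothesis WG : W <= G.
Hypothesis WS : W * W + W <= S.

Lemma lt_pow x : x < 2 ^ W -> x < 2 ^ G.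
Proof. by move=> xW; apply: leq_trans xW _; rewrite leq_exp2l. Qed.

Lemma size_lt_pow x : x <= W -> x < 2 ^ G.
Proof. by move=> xW; apply: lt_pow; apply: leq_ltn_trans xW (ltn_expl _ _). Qed.

Lemma io_lt_pow x : io x < 2 ^ G.
Proof. exact: lt_pow (layout_lt L x). Qed.

Definition partial_den (a k : nat) : nat :=
  (\prod_(0 <= b < a) \prod_(0 <= j < K b * 4) den b j) * \prod_(0 <= j < k) den a j.

Lemma partial_den0 a : partial_den a 0 = \prod_(0 <= b < a) \prod_(0 <= j < K b * 4) den b j.
Proof. by rewrite /partial_den (big_geq (leqnn 0)) muln1. Qed.

Lemma partial_denS a : partial_den a (K a * 4) = partial_den a.+1 0.
Proof. by rewrite partial_den0 big_nat_recr. Qed.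

Definition scanned (s : store) : Prop :=
  [/\ s Narcs 0 = A, s Src 0 = src, s Dst 0 = dst, s Den 0 = denominator
    & forall a, a < A -> s Off a = off a].

Lemma scan_prog_correct (s : store) : s IO =1 io -> wp S G scan_prog scanned s.
Proof.
move=> sIO; have := arcs_small => A_small.
do 5 (apply: wp_seq; apply: wp_asg => //=).
apply: wp_conseq.
  apply: (@wp_for _ _ _ _ _ (fun a (s : store) => [/\ s Den 0 = partial_den a 0, s Ptr 0 = off a
     & forall b, b < a -> s Off b = off b])) => //=.
  - by rewrite sIO (layout_A L); lia.
  - by rewrite partial_den0 big_geq // (layout_off0 L).
  rewrite sIO (layout_A L) => a s1 aA fr [denE ptrE offE].
  have eIO := fr IO isT; rewrite /= in eIO.
  have K_le := K_small aA; have K0 := layout_K0 L aA.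
  apply: wp_seq; apply: wp_asg => //=; apply: wp_seq; apply: wp_conseq.
    apply: (@wp_for _ _ _ _ _ (fun k (s : store) => s Den 0 = partial_den a k)) => //=.
    - by split=> //; apply: size_lt_pow; lia.
    - by rewrite eIO ptrE sIO (layout_K L) //; lia.
    rewrite eIO ptrE sIO (layout_K L) // => k s2 kK fr2 denE2.
    have eIO2 := fr2 IO isT; have ePtr := fr2 Ptr isT; rewrite /= in eIO2 ePtr.
    apply: wp_asg => //=; rewrite eIO2 ePtr eIO ptrE sIO layout_den //.
      split=> //; first by do 2!split=> //; apply: size_lt_pow; lia.
      by rewrite -(layout_den L) //; apply: io_lt_pow.
    by rewrite denE2 /partial_den big_nat_recr //= mulnA.
  rewrite /= eIO ptrE sIO (layout_K L) // => s2 fr2 denE2.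
  have eIO2 := fr2 IO isT; have ePtr := fr2 Ptr isT; have eOff := fr2 Off isT.
  rewrite /= in eIO2 ePtr eOff.
  apply: wp_asg => //=.
    by do 2!split=> //; apply: size_lt_pow; lia.
  rewrite eIO2 ePtr eOff eIO ptrE sIO (layout_K L) // (layout_offS L); split=> //.
    by rewrite denE2 partial_denS.
  by move=> b; rewrite ltnS leq_eqVlt; case: eqP => [->|_] //= /offE.
rewrite /= sIO (layout_A L) => s1 fr [denE ptrE offE].
split=> //; first by rewrite (fr Narcs isT) /= ?sIO ?(layout_A L).
- by rewrite (fr Src isT) /= ?sIO ?(layout_src L).
- by rewrite (fr Dst isT) /= ?sIO ?(layout_dst L).
- by rewrite denE partial_den0.
Qed.

Definition scaled (a k : nat) : nat := denominator %/ den a k * num a k.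
Definition endpoint (a j : nat) : nat :=
  if j < K a then scaled a (j * 4) else scaled a ((j - K a) * 4 + 1).
Definition prob_lo (a i : nat) : nat := scaled a (i * 4 + 2).
Definition prob_up (a i : nat) : nat := scaled a (i * 4 + 3).

Definition loaded (a : nat) (s : store) : Prop :=
  [/\ s Cons 0 = K a, s NumNodes 0 = K a + K a, s NumEdges 0 = (K a + K a) * (K a + K a),
    forall k, k < K a * 4 -> s Scaled k = scaled a k
    & forall j, j < K a + K a -> s Val j = endpoint a j].

Lemma load_prog_correct a (s : store) : a < A -> s Arc 0 = a -> s IO =1 io ->
  s Off a = off a -> s Den 0 = denominator ->
  wp S G load_prog (loaded a) s.
Proof.
move=> aA sa sIO sOff sDen; have K_le := K_small aA; have K0 := layout_K0 L aA.
apply: wp_seq; apply: wp_asg => //=; apply: wp_seq; apply: wp_asg => //=.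
rewrite sa sOff sIO (layout_K L) //.
apply: wp_seq; apply: wp_conseq.
  apply: (@wp_for _ _ _ _ _ (fun k (s : store) => forall j, j < k -> s Scaled j = scaled a j)) => //=.
  - by split=> //; apply: size_lt_pow; lia.
  - by lia.
  move=> k s1 kK fr IH.
  have eIO := fr IO isT; have eD := fr Den isT; have eB := fr Base isT; rewrite /= in eIO eD eB.
  have h2 : 2 < 2 ^ G by apply: size_lt_pow; lia.
  have hio x : s1 IO x < 2 ^ G by rewrite eIO sIO io_lt_pow.
  apply: wp_asg => //=.
  move=> j; rewrite ltnS leq_eqVlt; case: eqP => [->|_] /= H; last exact: IH.
  by rewrite eIO eB eD sDen !sIO (layout_den L) // (layout_num L).
move=> s1 fr sc.
have eB := fr Base isT; have eC := fr Cons isT; have eD := fr Den isT; rewrite /= in eB eC eD sc.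
apply: wp_seq; apply: wp_conseq.
  apply: (@wp_for _ _ _ _ _ (fun k (s : store) =>
    forall j, j < k -> s Val j = endpoint a j /\ s Val (K a + j) = endpoint a (K a + j))) => //=.
    by rewrite eC /=; lia.
  rewrite eC /= => k s2 kK fr2 IH.
  have eC2 := fr2 Cons isT; have eS := fr2 Scaled isT; rewrite /= in eC2 eS.
  apply: wp_seq; apply: wp_asg => //=.
    by split=> //; apply: size_lt_pow; lia.
  apply: wp_asg => //=.
    by do 2![split=> //]; apply: size_lt_pow; lia.
  rewrite eC2 eC eS /= !sc; try lia.
  move=> j; rewrite ltnS leq_eqVlt /endpoint => jk.
  have -> : (j == K a + k) = false by apply/eqP; move: jk => /orP [/eqP|]; lia.
  have -> : (K a + j < K a) = false by lia.
  have jK : j < K a by move: jk => /orP [/eqP|]; lia.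
  have -> : (K a + j == k) = false by apply/eqP; lia.
  rewrite eqn_add2l addKn jK; case: eqP jk => [-> _|_ /= jk]; first by [].
  by have := IH j jk; rewrite /endpoint jK addKn; have -> : (K a + j < K a) = false by lia.
rewrite /= eC => s2 fr2 val.
have eC2 := fr2 Cons isT; have eS := fr2 Scaled isT; rewrite /= in eC2 eS.
apply: wp_seq; apply: wp_asg => //=; rewrite eC2 eC /=.
apply: wp_asg => //=.
  by split=> //; apply: size_lt_pow; lia.
split=> //=; first by rewrite eC2 eC.
  by move=> k kK; rewrite eS sc.
move=> j jK; case: (ltnP j (K a)) => jK'; first by have [-> _] := val j jK'.
have jK2 : j - K a < K a by lia.
by have [_] := val _ jK2; rewrite subnKC.
Qed.

Definition edges_set (a : nat) (s : store) : Prop :=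
  let V := endpoint a in let D := denominator in
  s NumEdges 0 = cdf_edges (K a) /\
  forall e, e < cdf_edges (K a) ->
    [/\ s From e = cdf_from (K a) e, s Into e = cdf_into (K a) e,
      s Inc e = cdf_inc (K a) (prob_lo a) e & s Dec e = cdf_dec (K a) V (prob_up a) D e].

Lemma edges_prog_correct a (s : store) : a < A -> loaded a s -> s Den 0 = denominator ->
  wp S G edges_prog (edges_set a) s.
Proof.
move=> aA [sC sN sM sSc sV] sDen; have K_le := K_small aA; have K0 := layout_K0 L aA.
set n := K a + K a in sN sM sV *.
have nW : n <= W by rewrite /n; lia.
have nn : n * n <= W * W by apply: leq_mul.
pose ok e (s : store) := [/\ s From e = cdf_from (K a) e, s Into e = cdf_into (K a) e,
      s Inc e = cdf_inc (K a) (prob_lo a) e & s Dec e = cdf_dec (K a) (endpoint a) (prob_up a) denominator e].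
apply: wp_seq; apply: wp_conseq.
  apply: (@wp_for _ _ _ _ _ (fun k (s : store) => forall e, e < k -> ok e s)) => //=.
    by rewrite sM; lia.
  rewrite sM => k s1 kM fr IH.
  have eN := fr NumNodes isT; have eV := fr Val isT; have eD := fr Den isT.
  rewrite /= in eN eV eD.
  apply: wp_seq; apply: wp_asg => //=; apply: wp_seq; apply: wp_asg => //=.
    by do 2![split=> //]; rewrite eN sN; apply: size_lt_pow.
  apply: wp_seq; apply: wp_asg => //=; apply: wp_asg => //=.
    by split=> //; rewrite eD sDen; apply: lt_pow; apply: (layout_prod L).
  rewrite eN eV eD sN sDen.
  have kn : k %/ n < n by rewrite ltn_divLR // /n; lia.
  have km : k - k %/ n * n = k %% n by rewrite {1}(divn_eq k n) addKn.
  have n0 : 0 < n by rewrite /n; lia.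
  rewrite km eqxx !sV ?ltn_mod //.
  move=> e; rewrite ltnS leq_eqVlt /ok /=; case: eqP => [-> _|_ /= H]; last exact: IH.
  by rewrite /cdf_from /cdf_into /cdf_inc /cdf_dec -/n kM.
rewrite /= sM => s1 fr ok1.
have eN := fr NumNodes isT; have eM := fr NumEdges isT; have eC := fr Cons isT.
have eS := fr Scaled isT; rewrite /= in eN eM eC eS.
apply: wp_seq; apply: wp_conseq.
  apply: (@wp_for _ _ _ _ _ (fun k (s : store) => forall e, e < n * n + k -> ok e s)) => //=.
    by rewrite eN sN; lia.
    by rewrite addn0.
  rewrite eN sN => k s2 kn fr2 IH.
  have {}eM := etrans (fr2 NumEdges isT) eM; have {}eC := etrans (fr2 Cons isT) eC.
  have {}eS := etrans (fr2 Scaled isT) eS; rewrite /= in eM eC eS.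
  have Mk : (n * n + k < n * n) = false by lia.
  have h4 : 4 < 2 ^ G by apply: size_lt_pow; lia.
  apply: wp_seq; apply: wp_asg => //=; apply: wp_if => //=; rewrite eC sC => kK.
    apply: wp_seq; apply: wp_asg => //=; apply: wp_seq; apply: wp_asg => //=.
    apply: wp_asg => //=; rewrite ?eM ?eC ?eS ?sM ?sC.
    move=> e; rewrite addnS ltnS leq_eqVlt /ok /=; case: eqP => [-> _|_ /= H]; last exact: IH.
    rewrite /cdf_from /cdf_into /cdf_inc /cdf_dec -/n Mk addKn.
    have -> : k < K a by lia.
    by rewrite sSc //; lia.
  apply: wp_seq; apply: wp_asg => //=; apply: wp_seq; apply: wp_asg => //=.
  apply: wp_asg => //=; rewrite ?eM ?eC ?eS ?sM ?sC.
  move=> e; rewrite addnS ltnS leq_eqVlt /ok /=; case: eqP => [-> _|_ /= H]; last exact: IH.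
  rewrite /cdf_from /cdf_into /cdf_inc /cdf_dec -/n Mk addKn.
  have -> : (k < K a) = false by lia.
  by rewrite sSc //; lia.
rewrite /= eN sN => s2 fr2 ok2.
have eN2 := fr2 NumNodes isT; have eM2 := fr2 NumEdges isT; rewrite /= in eN2 eM2.
apply: wp_asg => //=; rewrite /edges_set /= eN2 eM2 eN eM sN sM; split=> //.
Qed.

End ArcLoading.

(** * The prices of the arcs and the route potential *)

Section Pricing.
Local Open Scope nat_scope.
Variables (S G W A src dst : nat) (K tl hd off io : nat -> nat) (num den : nat -> nat -> nat).

Let D := denominator A K den.
Let V (a : nat) := endpoint A K num den a.

Definition arc_pot (a : nat) : nat -> nat :=
  cdf_pot (K a) (V a) (prob_lo A K num den a) (prob_up A K num den a) D.

Definition scaled_cost (a : nat) : nat :=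
  arc_cost (K a) (V a) (prob_lo A K num den a) (prob_up A K num den a) D.

(** Shortest paths are searched for the costs [C * (A + 1) + 1]: these are
    positive, and since a path has at most [A] arcs, a shortest path for them is
    one for [C]. *)
Definition price (a : nat) : nat := scaled_cost a * (A + 1) + 1.

Definition big : nat := 1 + \sum_(0 <= a < A) price a.

Definition route_pot : nat -> nat :=
  relaxed A hd tl (fun=> 0) price (fun y => if y == dst then big else 0) A.

(** The constant potential [big] is feasible, because prices are nonnegative. *)
Lemma route_closed : closed_potential A hd tl (fun=> 0) price route_pot.
Proof.
apply: (@relaxed_closed _ _ _ _ _ int _ (fun=> big%:R)%R).
  by move=> e _; rewrite addr0 gerBl ler0n.
by move=> y; case: eqP => _; rewrite ?ler0n.
Qed.

Hypothesis L : layout W A src dst K tl hd off io num den.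
Hypothesis WG : W <= G.
Hypothesis WS : W * W + W <= S.

Hypothesis arc_closed : forall a, a < A ->
  closed_potential (cdf_edges (K a)) (cdf_from (K a)) (cdf_into (K a))
    (cdf_inc (K a) (prob_lo A K num den a)) (cdf_dec (K a) (V a) (prob_up A K num den a) D)
    (arc_pot a).
Hypothesis arc_pot_lt : forall a j, a < A -> arc_pot a j < 2 ^ W.
Hypothesis endpoint_le : forall a j, a < A -> j < K a + K a -> V a j <= V a (K a + K a - 1).

Definition input_kept (s : store) : Prop :=
  [/\ s IO =1 io, scanned A src dst K off den s & forall a, s Chosen a = 0].

Definition priced (k : nat) (s : store) : Prop :=
  [/\ forall y, s Pot y = 0, forall a, a < k -> s Price a = price a
    & s Big 0 = 1 + \sum_(0 <= a < k) price a].

Lemma price_prog_correct (s : store) : input_kept s -> (forall y, s Pot y = 0) ->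
  wp S G price_prog (priced A) s.
Proof.
move=> [sIO [sA _ _ sDen sOff] _] sPot; have A_small := arcs_small L.
apply: wp_seq; apply: wp_asg => //=.
have {1}<- : ev (upd s Big 0 1) ($Narcs)%P = A by [].
apply: (@wp_for _ _ _ _ _ priced) => //=; first by rewrite sA; lia.
  by split=> //=; rewrite big_geq.
rewrite sA => a s1 aA fr [pot0 prices bigE].
have eIO := fr IO isT; have eA := fr Narcs isT; have eD := fr Den isT; have eO := fr Off isT.
rewrite /= in eIO eA eD eO.
have K_le := K_small L aA; have K0 := layout_K0 L aA.
set n := K a + K a.
have nW : n <= W by rewrite /n; lia.
have nn : n * n <= W * W by apply: leq_mul.
apply: wp_seq; apply: wp_conseq.
  apply: (load_prog_correct L WG WS aA) => //=; first by move=> y; rewrite eIO.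
    by rewrite eO sOff.
  by rewrite eD.
move=> s2 fr2 l2.
have eD2 := etrans (fr2 Den isT) eD; have eA2 := etrans (fr2 Narcs isT) eA.
have eArc2 := fr2 Arc isT; have ePot2 := fr2 Pot isT; have ePr2 := fr2 Price isT.
have eBig2 := fr2 Big isT; rewrite /= in eArc2 ePot2 ePr2 eBig2.
apply: wp_seq; apply: wp_conseq.
  by apply: (edges_prog_correct L WG WS aA l2); rewrite eD2.
move=> s3 fr3 [eM3 edges3]; have [_ sN2 _ _ sV2] := l2.
have {}eD := etrans (fr3 Den isT) eD2; have {}eA := etrans (fr3 Narcs isT) eA2.
have eArc := etrans (fr3 Arc isT) eArc2; have ePot := etrans (fr3 Pot isT) ePot2.
have ePr := etrans (fr3 Price isT) ePr2; have eBig := etrans (fr3 Big isT) eBig2.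
have eN := fr3 NumNodes isT; have eV := fr3 Val isT.
apply: wp_seq; apply: wp_conseq.
  apply: (@relax_prog_correct S G (cdf_edges (K a)) _ _ _ _ (fun=> 0) s3 eM3 _ edges3) => //.
  - by rewrite /cdf_edges -/n; lia.
  - by move=> y; rewrite ePot pot0.
  - exact: arc_closed.
move=> s4 fr4 pot4.
have {}eD := etrans (fr4 Den isT) eD; have {}eA := etrans (fr4 Narcs isT) eA.
have {}eArc := etrans (fr4 Arc isT) eArc.
have {}ePr := etrans (fr4 Price isT) ePr; have {}eBig := etrans (fr4 Big isT) eBig.
have {}eN := etrans (fr4 NumNodes isT) eN; have {}eV := etrans (fr4 Val isT) eV.
apply: wp_seq; apply: wp_conseq.
  apply: (@sweep_prog_correct _ _ n (V a) (arc_pot a)) => //; rewrite ?eN ?sN2 ?eV //; try lia.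
  - by move=> j jn; apply: endpoint_le.
  - by move=> j _; apply: lt_pow (arc_pot_lt j aA).
move=> s5 fr5 area.
have {}eD := etrans (fr5 Den isT) eD; have {}eA := etrans (fr5 Narcs isT) eA.
have {}eArc := etrans (fr5 Arc isT) eArc; have ePot5 := fr5 Pot isT.
have {}ePr := etrans (fr5 Price isT) ePr; have {}eBig := etrans (fr5 Big isT) eBig.
have {}eN := etrans (fr5 NumNodes isT) eN; have {}eV := etrans (fr5 Val isT) eV.
have hD : s5 Den 0 < 2 ^ G by rewrite eD sDen; apply: (lt_pow WG (layout_prod L)).
have hA : s5 Narcs 0 + 1 < 2 ^ G by rewrite eA sA; apply: (size_lt_pow WG); lia.
apply: wp_seq; apply: wp_asg => //=.
rewrite eArc eN sN2 eV sV2; last by rewrite /n in K0 *; lia.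
rewrite eD sDen area eA sA -/(price a).
apply: wp_seq; apply: wp_asg => //=; rewrite eArc /= eBig bigE ePr.
apply: wp_conseq.
  apply: (@wp_for _ _ _ _ _ (fun k (s : store) => forall y, y < k \/ n <= y -> s Pot y = 0)) => //=.
  - by rewrite eN sN2; lia.
  - move=> y [//|ny]; rewrite ePot5 pot4; exact: cdf_pot_out.
  move=> k s6 _ fr6 IH; apply: wp_asg => //= y yk; case: eqP => // ne.
  by apply: IH; case: yk => yk; [left; lia | right].
rewrite /= eN sN2 => s6 fr6 pot6; split.
- by move=> y; apply: pot6; case: (ltnP y n); [left | right].
- move=> b; rewrite (fr6 Price isT) /= ltnS leq_eqVlt; case: eqP => [->|_] //= ba.
  by rewrite ?ePr prices.
- by rewrite (fr6 Big isT) /= big_nat_recr //= addnA eqxx.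
Qed.

Definition routed (s : store) : Prop :=
  [/\ s Pot =1 route_pot, forall a, a < A -> s From a = hd a & forall a, a < A -> s Into a = tl a].

Lemma route_prog_correct (s : store) : input_kept s -> priced A s ->
  wp S G route_prog routed s.
Proof.
move=> [sIO [sA _ sDst _ sOff] _] [pot0 prices bigE]; have A_small := arcs_small L.
apply: wp_seq; apply: wp_conseq.
  apply: (@wp_for _ _ _ _ _ (fun k (s : store) => forall e, e < k ->
    [/\ s From e = hd e, s Into e = tl e, s Inc e = 0 & s Dec e = price e])) => //=.
    by rewrite sA; lia.
  rewrite sA => k s1 kA fr IH.
  have eIO := fr IO isT; have eO := fr Off isT; have eP := fr Price isT.
  rewrite /= in eIO eO eP.
  apply: wp_seq; apply: wp_asg => //=; apply: wp_seq; apply: wp_asg => //=.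
  apply: wp_seq; apply: wp_asg => //=; apply: wp_asg => //= e.
  rewrite eIO eO eP sOff // !sIO (layout_hd L) // (layout_tl L) //.
  rewrite ltnS leq_eqVlt; case: eqP => [->|_] //= => [_|]; last exact: IH.
  by rewrite prices.
rewrite /= sA => s1 fr edges.
have eDst := fr Dst isT; have eB := fr Big isT; have eP := fr Pot isT; have eA := fr Narcs isT.
apply: wp_seq; apply: wp_asg => //=; apply: wp_seq; apply: wp_asg => //=.
apply: wp_conseq.
  apply: (@relax_prog_correct S G A hd tl (fun=> 0) price
    (fun y => if y == dst then big else 0)) => //=.
  - by rewrite eA.
  - by lia.
  - by move=> y; rewrite eDst sDst eB bigE eP pot0.
  - exact: route_closed.
move=> s2 fr2 pot; split=> //.
  by move=> a aA; rewrite (fr2 From isT) /=; have [] := edges a aA.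
by move=> a aA; rewrite (fr2 Into isT) /=; have [] := edges a aA.
Qed.

End Pricing.

(** * Tracing a shortest path *)

Section Tracing.
Local Open Scope nat_scope.
Variables (S G W A src dst : nat) (K tl hd off io : nat -> nat) (num den : nat -> nat -> nat).

Let D := denominator A K den.
Let pot := route_pot A dst K tl hd num den.
Let prc := price A K num den.
Let top := big A K num den.

Lemma route_pot_dst : pot dst = top.
Proof.
apply/eqP; rewrite eqn_leq; apply/andP; split.
  suff : ((pot dst)%:R <= top%:R :> int)%R by rewrite ler_nat.
  apply: (@relaxed_dominated _ _ _ _ _ int _ _ (fun=> top%:R)%R).
    by move=> e _; rewrite addr0 gerBl ler0n.
  by move=> y; case: eqP => _; rewrite ?ler0n.
have := @relaxed_le A hd tl (fun=> 0) prc (fun y => if y == dst then top else 0) 0 A dst isT.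
by rewrite /= eqxx.
Qed.

Lemma route_pot_max v : pot v <= top.
Proof.
suff : ((pot v)%:R <= top%:R :> int)%R by rewrite ler_nat.
apply: (@relaxed_dominated _ _ _ _ _ int _ _ (fun=> top%:R)%R).
  by move=> e _; rewrite addr0 gerBl ler0n.
by move=> y; case: eqP => _; rewrite ?ler0n.
Qed.

Lemma price_gt0 a : 0 < prc a.
Proof. by rewrite /prc /price addn1. Qed.

Definition tight (v a : nat) : bool := (tl a == v) && (pot v + prc a == pot (hd a)).

(** The potential of [v] was raised above its initial value zero by some arc. *)
Lemma tight_exists v : v != dst -> 0 < pot v -> exists2 a, a < A & tight v a.
Proof.
move=> vd v0.
have : pot v = (if v == dst then top else 0) \/
    exists a, [/\ a < A, tl a = v & pot v <= pot (hd a) + 0 - prc a].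
  exact: (relaxed_tight A hd tl (fun=> 0) prc (fun y => if y == dst then top else 0) A v).
rewrite (negPf vd) => -[|[a [aA av le]]]; first by lia.
have cl : pot (hd a) + 0 - prc a <= pot (tl a) := @route_closed A dst K tl hd num den a aA.
by exists a => //; rewrite /tight av eqxx /=; move: cl; rewrite av; lia.
Qed.

(** [Y] marks the arcs of a walk from [src] to [v] along tight arcs. The
    potential increases along such a walk, so no arc is used twice. *)
Record walk (v : nat) (Y : nat -> nat) : Prop := Walk {
  walk01 : forall a, Y a = 0 \/ Y a = 1;
  walk_flow : forall i, \sum_(0 <= a < A | tl a == i) Y a + (i == v) =
                        \sum_(0 <= a < A | hd a == i) Y a + (i == src);
  walk_cost : \sum_(0 <= a < A) Y a * prc a + pot src = pot v;
  walk_pot : forall a, Y a = 1 -> pot (tl a) < pot v;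
  walk_gt0 : 0 < pot v
}.

Lemma sum_mark (Y : nat -> nat) (F : nat -> nat) (p : pred nat) a : a < A -> Y a = 0 ->
  \sum_(0 <= b < A | p b) (if b == a then 1 else Y b) * F b =
  \sum_(0 <= b < A | p b) Y b * F b + (if p a then F a else 0).
Proof.
move=> aA Ya; rewrite !big_mkord big_mkcond [in RHS]big_mkcond.
rewrite (bigD1 (Ordinal aA)) //= [in RHS](bigD1 (Ordinal aA)) //= eqxx Ya mul1n mul0n.
rewrite if_same add0n addnC; congr addn; apply: eq_bigr => i.
by rewrite -val_eqE /= => /negPf ->.
Qed.

Lemma sum_mark1 (Y : nat -> nat) (p : pred nat) a : a < A -> Y a = 0 ->
  \sum_(0 <= b < A | p b) (if b == a then 1 else Y b) = \sum_(0 <= b < A | p b) Y b + p a.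
Proof.
move=> aA Ya; have := sum_mark (fun=> 1) p aA Ya.
under eq_bigr do rewrite muln1; under [X in _ = X + _ -> _]eq_bigr do rewrite muln1.
by move=> ->; case: (p a).
Qed.

(** The potential of the tail of [a] is that of [v], above all tails of marked
    arcs: so [a] is new. *)
Lemma walk_step v Y a : walk v Y -> a < A -> tight v a ->
  Y a = 0 /\ walk (hd a) (fun b => if b == a then 1 else Y b).
Proof.
move=> [Y01 flow cost inc gt0] aA /andP [/eqP av /eqP ah]; have pa := price_gt0 a.
have Ya : Y a = 0 by case: (Y01 a) => // /inc; rewrite av ltnn.
split=> //; split.
- by move=> b; case: eqP => _; [right | apply: Y01].
- move=> i; rewrite !sum_mark1 // av; have := flow i; rewrite ![_ == i]eq_sym; lia.
- by rewrite (sum_mark _ xpredT) //=; lia.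
- by move=> b; case: eqP => [-> _|_ /inc]; rewrite ?av; lia.
- by lia.
Qed.

Hypothesis A_small : A <= S.

Definition traced (s : store) : Prop := walk dst (s Chosen).

Lemma trace_prog_correct (s : store) : s Narcs 0 = A -> s Src 0 = src ->
  (forall a, s Chosen a = 0) -> 0 < pot src ->
  (forall a, a < A -> [/\ s From a = hd a, s Into a = tl a & s Price a = prc a]) ->
  s Pot =1 pot -> wp S G trace_prog traced s.
Proof.
move=> sA sSrc sCh src0 sArcs sPot.
apply: wp_seq; apply: wp_asg => //=; rewrite sSrc.
pose marked (s : store) := \sum_(0 <= a < A) s Chosen a.
apply: wp_conseq.
  apply: (@wp_for _ _ _ _ _ (fun r (s : store) =>
    walk (s Here 0) (s Chosen) /\ (s Here 0 = dst \/ r <= marked s))) => //=.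
  - by rewrite sA.
  - split; last by right.
    split=> //; first by move=> a; left.
    + by move=> i; rewrite !big1_seq.
    + by rewrite big1_seq // => i _; rewrite sCh.
    + by move=> a; rewrite sCh.
  rewrite sA => r s1 rA fr [w1 cnt].
  have eA := fr Narcs isT; rewrite /= in eA.
  (* Within a pass, either an arc has been marked or none of those scanned is tight. *)
  apply: wp_conseq.
    apply: (@wp_for _ _ _ _ _ (fun k (s : store) =>
      walk (s Here 0) (s Chosen) /\ [\/ s Here 0 = dst, r < marked s
         | r <= marked s /\ forall a, a < k -> ~~ tight (s Here 0) a])) => //=.
    - by rewrite eA sA.
    - by split=> //; case: cnt => cnt; [constructor 1 | constructor 3].
    rewrite eA sA => k s2 kA fr2 [w2 cnt2].
    have eF := etrans (fr2 From isT) (fr From isT); have eI := etrans (fr2 Into isT) (fr Into isT).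
    have ePr := etrans (fr2 Price isT) (fr Price isT).
    have ePo := etrans (fr2 Pot isT) (fr Pot isT); rewrite /= in eF eI ePr ePo.
    have [sF sI sP] := sArcs k kA.
    apply: wp_if => //=; rewrite eF eI ePr ePo sF sI sP !sPot => dist.
      apply: wp_asg => //=; split=> //=.
      case: cnt2 => [?|?|[cnt2 nt]]; [by constructor 1 | by constructor 2 | constructor 3].
      split=> // a; rewrite ltnS leq_eqVlt => /orP [/eqP ->|/nt //].
      by rewrite /tight; apply/negP => /andP [/eqP e1 /eqP e2]; move: dist; rewrite e1 e2; lia.
    have ti : tight (s2 Here 0) k by rewrite /tight; apply/andP; split; apply/eqP; lia.
    have [Y0 w3] := walk_step w2 kA ti.
    apply: wp_seq; apply: wp_asg => //=; apply: wp_asg => //=; rewrite eF sF; split=> //=.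
    constructor 2; rewrite /marked /= sum_mark1 //= addn1 ltnS.
    case: cnt2 => [here_dst|/ltnW //|[] //].
    move: ti; rewrite /tight here_dst => /andP [_ /eqP E1].
    by have := route_pot_max (hd k); have := price_gt0 k; rewrite -E1 route_pot_dst; lia.
  rewrite /= eA sA => s2 fr2 [w2 cnt2]; split=> //.
  case: (eqVneq (s2 Here 0) dst) => [E1|nd]; [by left | right].
  case: cnt2 => [/eqP|//|[_ nt]]; first by rewrite (negPf nd).
  by have [a aA ta] := tight_exists nd (walk_gt0 w2); have := nt a aA; rewrite ta.
rewrite /= sA => s1 fr [w1 cnt]; rewrite /traced.
case: (eqVneq (s1 Here 0) dst) => [<- //|nd]; exfalso.
case: cnt => [/eqP|cnt]; first by rewrite (negPf nd).
have [a aA ta] := tight_exists nd (walk_gt0 w1).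
have [Y0 _] := walk_step w1 aA ta.
move: cnt; rewrite leqNgt => /negP; apply; rewrite /marked.
rewrite big_mkord (bigD1 (Ordinal aA)) //= Y0 add0n.
apply: leq_ltn_trans (_ : \sum_(i < A | i != Ordinal aA) 1 < A).
  by apply: leq_sum => i _; case: (walk01 w1 i) => ->.
by rewrite sum1_card cardC1 card_ord; lia.
Qed.

Definition path_word (Y : nat -> nat) : seq nat :=
  [:: 1; (top - pot src) %/ (A + 1); D * D] ++ mkseq Y A.

Lemma output_prog_correct (s : store) : s Narcs 0 = A -> s Src 0 = src -> s Big 0 = top ->
  s Pot =1 pot -> s Den 0 = D -> D < 2 ^ G ->
  wp S G output_prog (fun s' => forall i, i < A + 3 -> s' IO i = nth 0 (path_word (s Chosen)) i) s.
Proof.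
move=> sA sSrc sB sPot sD DG.
apply: wp_seq; apply: wp_asg => //=; apply: wp_seq; apply: wp_asg => //=.
apply: wp_seq; apply: wp_asg => //=; first by rewrite sD.
apply: wp_conseq.
  apply: (@wp_for _ _ _ _ _ (fun k (s' : store) =>
    forall i, i < k + 3 -> s' IO i = nth 0 (path_word (s Chosen)) i)) => //=.
    by rewrite sA.
    move=> [|[|[|i]]] //= _; first by rewrite sB sSrc sPot sA.
    by rewrite sD.
  rewrite sA => k s1 kA fr IH; apply: wp_asg => //= i ik.
  rewrite (fr Chosen isT) /=; case: eqP => [->|ne]; last by apply: IH; lia.
  by rewrite addn3 /= nth_mkseq.
by rewrite /= sA.
Qed.

End Tracing.

Section WholeProgram.
Local Open Scope nat_scope.
Variables (S G W A src dst : nat) (K tl hd off io : nat -> nat) (num den : nat -> nat -> nat).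

Definition arcs_consistent : Prop := forall a, a < A ->
  [/\ closed_potential (cdf_edges (K a)) (cdf_from (K a)) (cdf_into (K a))
        (cdf_inc (K a) (prob_lo A K num den a))
        (cdf_dec (K a) (endpoint A K num den a) (prob_up A K num den a) (denominator A K den))
        (arc_pot A K num den a),
      forall j, arc_pot A K num den a j < 2 ^ W
    & forall j, j < K a + K a -> endpoint A K num den a j <= endpoint A K num den a (K a + K a - 1)].

Lemma drsp_prog_correct (s : store) : layout W A src dst K tl hd off io num den ->
  W <= G -> W * W + W <= S -> arcs_consistent -> s IO =1 io ->
  (forall a i, code a != 0 -> s a i = 0) ->
  wp S G drsp_prog (fun s' =>
    (route_pot A dst K tl hd num den src = 0 /\ s' IO 0 = 0) \/
    (0 < route_pot A dst K tl hd num den src /\ exists2 Y,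
       walk A src dst K tl hd num den dst Y &
       forall i, i < A + 3 -> s' IO i = nth 0 (path_word A src dst K tl hd num den Y) i)) s.
Proof.
move=> L WG WS arcs sIO s0; have A_small := arcs_small L.
have AS : A <= S by lia.
apply: wp_seq; apply: wp_conseq; first exact: (scan_prog_correct L WG WS sIO).
move=> s1 fr1 sc1.
have in1 : input_kept A src dst K off io den s1.
  split=> //; first by move=> i; rewrite (fr1 IO isT).
  by move=> a; rewrite (fr1 Chosen isT) s0.
apply: wp_seq; apply: wp_conseq.
  apply: (price_prog_correct L WG WS _ _ _ in1) => //.
  - by move=> a aA; have [] := arcs a aA.
  - by move=> a j aA; have [] := arcs a aA.
  - by move=> a j aA; have [_ _] := arcs a aA; apply.
  - by move=> y; rewrite (fr1 Pot isT) s0.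
move=> s2 fr2 pr2.
have in2 : input_kept A src dst K off io den s2.
  case: in1 => e1 [h1 h2 h3 h4 h5] e2; split.
  - by move=> i; rewrite (fr2 IO isT).
  - split; rewrite ?(fr2 Narcs isT) ?(fr2 Src isT) ?(fr2 Dst isT) ?(fr2 Den isT) //.
    by move=> a aA; rewrite (fr2 Off isT) h5.
  - by move=> a; rewrite (fr2 Chosen isT).
apply: wp_seq; apply: wp_conseq; first exact: (route_prog_correct L WG WS in2 pr2).
move=> s3 fr3 [pot3 from3 into3].
have [_ [sA sSrc sDst sDen sOff] sCh] := in2; have [_ prices bigE] := pr2.
apply: wp_if => //=; rewrite (fr3 Src isT) sSrc pot3 => pot_src; last first.
  by apply: wp_asg => //=; left.
apply: wp_seq; apply: wp_conseq.
  apply: (@trace_prog_correct S G A src dst K tl hd num den) => //.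
  - by rewrite (fr3 Narcs isT).
  - by rewrite (fr3 Src isT).
  - by move=> a; rewrite (fr3 Chosen isT).
  - by move=> a aA; rewrite (fr3 Price isT) from3 // into3 // prices.
move=> s4 fr4 w4; apply: wp_conseq.
  apply: (@output_prog_correct S G A src dst K tl hd num den) => //.
  - by rewrite (fr4 Narcs isT) (fr3 Narcs isT).
  - by rewrite (fr4 Src isT) (fr3 Src isT).
  - by rewrite (fr4 Big isT) (fr3 Big isT).
  - by move=> y; rewrite (fr4 Pot isT).
  - by rewrite (fr4 Den isT) (fr3 Den isT).
  - exact: lt_pow (layout_prod L).
move=> s5 fr5 out; right; split=> //.
by exists (s4 Chosen).
Qed.

End WholeProgram.

(** * Uniform distributions on finitely many atoms *)

Section UniformAtoms.
Local Open Scope ring_scope.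
Local Open Scope classical_set_scope.
Local Open Scope ereal_scope.
Context d (T : measurableType d) (R : realType).
Variables (pt : nat -> T) (D : nat).

Definition atoms_mass : {measure set T -> \bar R} :=
  mscale (D%:R^-1)%:nng%R (msum (fun k => \d_(pt k)) D).

Definition uniform_atoms : probability T R := mnormalize atoms_mass (\d_(pt 0)).

Hypothesis D0 : (0 < D)%N.

Lemma atoms_massE A : atoms_mass A = (D%:R^-1 * \sum_(k < D) (pt k \in A)%:R)%R%:E.
Proof.
by rewrite /atoms_mass /= /mscale /= /msum EFinM -sumEFin.
Qed.

Lemma uniform_atomsE A : uniform_atoms A = (D%:R^-1 * \sum_(k < D) (pt k \in A)%:R)%R%:E.
Proof.
have one : atoms_mass [set: T] = 1.
  rewrite atoms_massE; congr EFin.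
  under eq_bigr do rewrite in_setT; rewrite sumr_const card_ord /= mulVf //.
  by rewrite pnatr_eq0 -lt0n.
rewrite /uniform_atoms /= /mnormalize one.
have -> /= : (1 == 0 :> \bar R) || (1 == +oo :> \bar R) = false.
  by rewrite orbF; apply/negbTE; rewrite onee_eq0.
by rewrite invr1 mule1 atoms_massE.
Qed.

(** The integrals of the positive and negative parts are finite sums. *)
Lemma uniform_atoms_expectation (X : T -> R) : measurable_fun setT X ->
  'E_uniform_atoms[X] = (D%:R^-1 * \sum_(k < D) X (pt k))%R%:E.
Proof.
move=> mX.
have ge0 (f : T -> \bar R) : measurable_fun setT f -> (forall x, 0 <= f x) ->
    \int[uniform_atoms]_w f w = (D%:R^-1)%R%:E * \sum_(k < D) f (pt k).
  move=> mf f0; rewrite (eq_measure_integral atoms_mass); last first.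
    by move=> A mA _; exact: etrans (uniform_atomsE A) (esym (atoms_massE A)).
  rewrite ge0_integral_mscale // ge0_integral_measure_sum //; congr (_ * _).
  by apply: eq_bigr => k _; rewrite integral_dirac // diracT mul1e.
have mEX : measurable_fun setT (EFin \o X) by exact/measurable_EFinP.
rewrite unlock integralE !ge0 //; [|exact: measurable_funeneg|exact: measurable_funepos].
have posE : \sum_(k < D) (fun w => (X w)%:E)^\+ (pt k) = \sum_(k < D) (Num.max (X (pt k)) 0)%R%:E.
  by apply: eq_bigr => k _; rewrite funeposE EFin_max.
have negE : \sum_(k < D) (fun w => (X w)%:E)^\- (pt k) = \sum_(k < D) (Num.max (- X (pt k)) 0)%R%:E.
  by apply: eq_bigr => k _; rewrite funenegE EFin_max.
rewrite posE negE.
rewrite !sumEFin -!EFinM -EFinB; congr EFin.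
rewrite -mulrBr -sumrB; congr (_ * _)%R; apply: eq_bigr => k _.
by case: (lerP (X (pt k)) 0) => h; rewrite /Num.max; case: ltP; case: ltP; lra.
Qed.

End UniformAtoms.

(** * The least distribution function and its quantiles *)

Section Quantile.
Local Open Scope nat_scope.
Variables (K : nat) (V ql qu : nat -> nat) (D : nat).

Let pot := cdf_pot K V ql qu D.
Let cdf := step_cdf (K + K) V pot.
Let U := V (K + K - 1).

Hypothesis K0 : 0 < K.
Hypothesis pot_closed :
  closed_potential (cdf_edges K) (cdf_from K) (cdf_into K) (cdf_inc K ql) (cdf_dec K V qu D) pot.
Hypothesis pot_le : forall j, pot j <= D.
Hypothesis V_le : forall j, j < K + K -> V j <= U.

Lemma pot_mono i j : i < K + K -> j < K + K -> V i <= V j -> pot i <= pot j.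
Proof.
move=> iN jN ij; have eM : i * (K + K) + j < (K + K) * (K + K) by nia.
have /pot_closed : i * (K + K) + j < cdf_edges K by rewrite /cdf_edges; lia.
rewrite /gain /cdf_from /cdf_into /cdf_inc /cdf_dec eM divnMDl; last by lia.
rewrite divn_small // !addn0 modnMDl modn_small //.
have -> : V i - V j = 0 by apply/eqP.
by rewrite mul0n; lia.
Qed.

Lemma pot_lo i : i < K -> pot i + ql i <= pot (K + i).
Proof.
move=> iK; have /pot_closed : (K + K) * (K + K) + i < cdf_edges K by rewrite /cdf_edges; lia.
rewrite /gain /cdf_from /cdf_into /cdf_inc /cdf_dec.
by rewrite [_ + i < _]ltnNge leq_addr /= addKn iK; lia.
Qed.

Lemma pot_up i : i < K -> pot (K + i) <= pot i + qu i.
Proof.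
move=> iK; have /pot_closed : (K + K) * (K + K) + (K + i) < cdf_edges K by rewrite /cdf_edges; lia.
rewrite /gain /cdf_from /cdf_into /cdf_inc /cdf_dec.
rewrite [_ + (K + i) < _]ltnNge leq_addr /= addKn ltnNge leq_addr /= addKn; lia.
Qed.

Lemma cdf_le z : cdf z <= D.
Proof.
rewrite /cdf /step_cdf; elim/big_ind: _ => // x y xD yD.
by rewrite geq_max xD.
Qed.

Lemma cdf_mono z z' : z <= z' -> cdf z <= cdf z'.
Proof.
move=> zz'; rewrite /cdf /step_cdf !big_mkord; apply/bigmax_leqP => j jz.
by apply: (@leq_bigmax_cond _ _ (fun j : 'I__ => pot j)); apply: leq_trans jz zz'.
Qed.

Lemma cdf_attained z : cdf z = 0 \/ exists j, [/\ j < K + K, V j <= z & cdf z = pot j].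
Proof.
rewrite /cdf /step_cdf big_mkord.
case: (posnP #|[pred i : 'I_(K + K) | V i <= z]|) => [/card0_eq c0|c].
  by left; rewrite big_pred0.
have [j jz jE] := @eq_bigmax_cond _ [pred i : 'I_(K + K) | V i <= z] (fun i : 'I__ => pot i) c.
by right; exists j; split=> //; rewrite -jE.
Qed.

Lemma cdf_endpoint j : j < K + K -> cdf (V j) = pot j.
Proof.
move=> jN; apply/eqP; rewrite eqn_leq; apply/andP; split.
  rewrite /cdf /step_cdf big_mkord; apply/bigmax_leqP => i iV; exact: pot_mono.
rewrite /cdf /step_cdf big_mkord.
exact: (@leq_bigmax_cond _ (fun i : 'I__ => V i <= V j) (fun i : 'I__ => pot i) (Ordinal jN)).
Qed.

(** As [cdf] is increasing, the counted points are those before the place where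
    [cdf] exceeds the level [w]. *)
Definition quantile (w : nat) : nat := \sum_(0 <= z < U) (cdf z <= w).

Lemma sum_lt_const n m : m <= n -> \sum_(0 <= w < n) (w < m) = m.
Proof.
move=> mn; rewrite (big_cat_nat (leq0n m) mn) /=.
rewrite (eq_big_nat _ _ (F2 := fun=> 1)); last by move=> i /andP [_ ->].
rewrite [X in _ + X](eq_big_nat _ _ (F2 := fun=> 0)); last by move=> i /andP [h _]; rewrite ltnNge h.
by rewrite !sum_nat_const_nat; lia.
Qed.

Lemma arc_costE : arc_cost K V ql qu D = \sum_(0 <= z < U) (D - cdf z).
Proof.
rewrite sumnB; last by move=> z _; apply: cdf_le.
by rewrite sum_nat_const_nat subn0.
Qed.

(** Both sides count the pairs of a point and a level with [cdf z <= w]. *)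
Lemma sum_quantile : \sum_(0 <= w < D) quantile w = arc_cost K V ql qu D.
Proof.
rewrite arc_costE exchange_big /=; apply: eq_big_nat => z _.
have := sum_lt_const (cdf_le z).
have : \sum_(0 <= w < D) ((w < cdf z) + (cdf z <= w)) = D.
  rewrite (eq_bigr (fun=> 1)) ?sum_nat_const_nat ?subn0 ?muln1 // => w _.
  by case: ltnP.
by rewrite big_split /=; lia.
Qed.

Hypothesis support_prob : ql (K - 1) = D.

(** Strictness at the last end point, where counting stops, comes from the total
    mass [D]. *)
Lemma quantile_le j w : j < K + K -> w < D -> (quantile w <= V j) = (w < pot j).
Proof.
move=> jN wD; rewrite -cdf_endpoint //; have VU := V_le jN; case: (ltnP w (cdf (V j))) => h.
  rewrite -(sum_lt_const VU); apply: leq_sum => z _.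
  case: (ltnP z (V j)) => zj; first by rewrite leq_b1.
  by have := cdf_mono zj; lia.
have VU' : V j < U.
  rewrite ltn_neqAle VU andbT; apply/eqP => VjU.
  have := @pot_lo (K - 1); have := @cdf_endpoint (K + K - 1); rewrite -/U -VjU support_prob.
  by rewrite (_ : K + (K - 1) = K + K - 1); lia.
apply/negbTE; rewrite -ltnNge -(sum_lt_const VU'); apply: leq_sum => z _.
by case: (ltnP z (V j).+1) => // zj; have := cdf_mono (zj : z <= V j); lia.
Qed.

Lemma count_quantile_between i : i < K ->
  \sum_(0 <= w < D) ((V i < quantile w) && (quantile w <= V (K + i))) = pot (K + i) - pot i.
Proof.
move=> iK; have lo := pot_lo iK.
have := sum_lt_const (pot_le i); have := sum_lt_const (pot_le (K + i)).
have : \sum_(0 <= w < D) (((V i < quantile w) && (quantile w <= V (K + i))) + (w < pot i)) =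
       \sum_(0 <= w < D) (w < pot (K + i)).
  apply: eq_big_nat => w /andP [_ wD].
  by rewrite ltnNge !quantile_le //; lia.
by rewrite big_split /=; lia.
Qed.

End Quantile.

(** * The expected cost of an arc *)

Section ArcExpectation.
Local Open Scope classical_set_scope.
Local Open Scope ring_scope.
Context d (T : measurableType d) (R : realType).
Variables (P : probability T R) (X : T -> R).
Variables (K : nat) (V ql qu : nat -> nat) (D : nat).

Let N := (K + K)%N.
Let pot := cdf_pot K V ql qu D.
Let cdf := step_cdf N V pot.
Let U := V (N - 1)%N.

Hypothesis mX : measurable_fun setT X.
Hypothesis K0 : (0 < K)%N.
Hypothesis D0 : (0 < D)%N.
Hypothesis V_neq : forall i j, (i < K)%N -> (j < K)%N -> V i <> V (K + j)%N.
Hypothesis V_le : forall i, (i < K)%N -> (V i <= V (K + i))%N.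
Hypothesis constraints : forall i, (i < K)%N ->
  (((ql i)%:R / D%:R)%:E <= P [set w | ((V i)%:R <= X w <= (V (K + i)%N)%:R)%R]
                         <= ((qu i)%:R / D%:R)%:E)%E.

(** Chosen so that a closed interval is the difference of the events of its two
    end points. *)
Definition before (j : nat) : set T :=
  if (j < K)%N then [set w | X w < (V j)%:R] else [set w | X w <= (V j)%:R].

Lemma measurable_before j : measurable (before j).
Proof.
have E (A : set R) : measurable A -> measurable (X @^-1` A).
  by move=> mA; rewrite -[X in measurable X]setTI; apply: mX.
rewrite /before; case: ifP => _.
  have -> : [set w | X w < (V j)%:R] = X @^-1` `]-oo, (V j)%:R[.
    by apply/seteqP; split=> w /=; rewrite in_itv.
  by apply: E; apply: measurable_itv.
have -> : [set w | X w <= (V j)%:R] = X @^-1` `]-oo, (V j)%:R].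
  by apply/seteqP; split=> w /=; rewrite in_itv.
by apply: E; apply: measurable_itv.
Qed.

Lemma measurable_between i : measurable [set w | (V i)%:R <= X w <= (V (K + i)%N)%:R].
Proof.
have -> : [set w | (V i)%:R <= X w <= (V (K + i)%N)%:R] = X @^-1` `[(V i)%:R, (V (K + i)%N)%:R].
  by apply/seteqP; split=> w /=; rewrite in_itv.
by rewrite -[X in measurable X]setTI; apply: mX => //; apply: measurable_itv.
Qed.

Definition cdf_of (j : nat) : R := if (j < N)%N then fine (P (before j)) * D%:R else 0.

Lemma before_fin j : P (before j) = (fine (P (before j)))%:E.
Proof. by rewrite fineK // fin_num_measure //; apply: measurable_before. Qed.

Lemma fine_before_ge0 j : 0 <= fine (P (before j)).
Proof. exact: fine_ge0. Qed.

Lemma fine_before_le1 j : fine (P (before j)) <= 1.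
Proof. by rewrite -lee_fin -before_fin; apply: probability_le1; apply: measurable_before. Qed.

Lemma cdf_of_ge0 j : 0 <= cdf_of j.
Proof. by rewrite /cdf_of; case: ifP => // _; rewrite mulr_ge0 // fine_before_ge0. Qed.

Lemma cdf_of_le j : cdf_of j <= D%:R.
Proof.
rewrite /cdf_of; case: ifP => // _.
by rewrite -[leRHS]mul1r ler_wpM2r // fine_before_le1.
Qed.

(** For a right end point followed by a left one, the inclusion needs the two to
    be different. *)
Lemma before_sub i j : (i < N)%N -> (j < N)%N -> (V i <= V j)%N -> before i `<=` before j.
Proof.
move=> iN jN ij w; have ijR : (V i)%:R <= (V j)%:R :> R by rewrite ler_nat.
rewrite /before; case: (ltnP i K) => iK; case: (ltnP j K) => jK /= H.
- exact: lt_le_trans H ijR.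
- exact: le_trans (ltW H) ijR.
- have := @V_neq j (i - K) jK; rewrite subnKC // => ne.
  apply: le_lt_trans H _; rewrite ltr_nat ltn_neqAle ij andbT.
  by apply/eqP => e; apply: ne => //; rewrite /N in iN; lia.
- exact: le_trans H ijR.
Qed.

Lemma cdf_of_mono i j : (i < N)%N -> (j < N)%N -> (V i <= V j)%N -> cdf_of i <= cdf_of j.
Proof.
move=> iN jN ij; rewrite /cdf_of iN jN ler_wpM2r // -lee_fin -!before_fin.
by apply: le_measure; rewrite ?inE; [exact: measurable_before..|exact: before_sub].
Qed.

Lemma cdf_of_between i : (i < K)%N ->
  cdf_of i + (ql i)%:R <= cdf_of (K + i) <= cdf_of i + (qu i)%:R.
Proof.
move=> iK; have iN : (i < N)%N by rewrite /N; lia.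
have iN' : (K + i < N)%N by rewrite /N; lia.
set I := [set w | (V i)%:R <= X w <= (V (K + i)%N)%:R].
have Ke : (K + i < K)%N = false by lia.
have ViR : (V i)%:R <= (V (K + i)%N)%:R :> R by rewrite ler_nat; apply: V_le.
have E : before (K + i) = before i `|` I.
  rewrite /before iK Ke; apply/seteqP; split=> w /=.
    by case: (ltP (X w) (V i)%:R) => h h'; [left | right; rewrite /I /= h h'].
  by case=> [h|/andP [_ //]]; apply: le_trans (ltW h) ViR.
have PE : P (before (K + i)) = (P (before i) + P I)%E.
  rewrite E measureU //; [exact: measurable_before | exact: measurable_between|].
  rewrite /before iK; apply/seteqP; split=> // w [] /= h /andP [h' _].
  by move: h; rewrite ltNge h'.
have If : P I = (fine (P I))%:E.
  by rewrite fineK // fin_num_measure //; apply: measurable_between.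
have := constraints iK; rewrite -/I If !lee_fin => /andP [c1 c2].
have D0R : 0 < D%:R :> R by rewrite ltr0n.
move: PE; rewrite before_fin (before_fin i) If -EFinD => -[PE].
rewrite /cdf_of iN iN' PE mulrDl !lerD2l; apply/andP; split.
  by rewrite -ler_pdivrMr.
by rewrite -ler_pdivlMr.
Qed.

(** The distribution function of every admissible law is a solution, so the
    relaxation has a fixpoint, and that lies below all of them. *)
Lemma cdf_of_feasible :
  feasible (cdf_edges K) (cdf_from K) (cdf_into K) (cdf_inc K ql) (cdf_dec K V qu D) cdf_of.
Proof.
move=> e; rewrite /cdf_edges /cdf_from /cdf_into /cdf_inc /cdf_dec -/N => eE.
case: ifP => eM.
  have N0 : (0 < N)%N by rewrite /N; lia.
  have fN : (e %/ N < N)%N by rewrite ltn_divLR.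
  have mN : (e %% N < N)%N by rewrite ltn_mod.
  rewrite addr0; case: (leqP (V (e %/ N)) (V (e %% N))) => h.
    rewrite (_ : (V (e %/ N) - V (e %% N) = 0)%N); last by lia.
    by rewrite mul0n subr0 cdf_of_mono.
  have : (D <= (V (e %/ N) - V (e %% N)) * D)%N by apply: leq_pmull; lia.
  rewrite -(ler_nat R) => hD; have := cdf_of_le (e %/ N); have := cdf_of_ge0 (e %% N).
  by lra.
case: ifP => eK.
  by rewrite subr0; have /andP [] := cdf_of_between eK.
have iK : (e - N * N - K < K)%N by rewrite /N in eE eM eK *; lia.
have -> : (e - N * N = K + (e - N * N - K))%N by lia.
rewrite addKn addr0.
by have /andP [_] := cdf_of_between iK; rewrite lerBlDr.
Qed.

Lemma cdf_of_dominates0 : dominates (fun=> 0%N) cdf_of.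
Proof. by move=> y; apply: cdf_of_ge0. Qed.

Lemma arc_pot_closed :
  closed_potential (cdf_edges K) (cdf_from K) (cdf_into K) (cdf_inc K ql) (cdf_dec K V qu D) pot.
Proof. exact: relaxed_closed cdf_of_feasible cdf_of_dominates0. Qed.

Lemma arc_pot_cdf_of j : (pot j)%:R <= cdf_of j.
Proof. exact: (relaxed_dominated _ cdf_of_feasible cdf_of_dominates0). Qed.

Lemma arc_pot_le j : (pot j <= D)%N.
Proof. by rewrite -(ler_nat R); apply: le_trans (arc_pot_cdf_of j) (cdf_of_le j). Qed.

(** The number of naturals below [x] is [x] rounded up. *)
Lemma le_count (x : R) n : x <= n%:R -> x <= \sum_(0 <= z < n) (z%:R < x)%R%:R.
Proof.
suff : Num.min x n%:R <= \sum_(0 <= z < n) (z%:R < x)%R%:R.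
  by move=> H xn; move: H; rewrite min_l.
elim: n => [|n IH]; first by rewrite big_geq // ge_min lexx orbT.
rewrite big_nat_recr //= -natr1; move: IH; rewrite /Num.min.
by case: ltP => h1; case: ltP => h2; case: ltP => h3 /=; lra.
Qed.

(** An event on which [X <= z], of probability at least [cdf z / D]: the one of
    an end point where the maximum defining [cdf z] is attained. *)
Definition level_event (z : nat) : set T :=
  if [pick j : 'I_N | (V j <= z)%N && (pot j == cdf z)] is Some j then before j else set0.

Lemma measurable_level_event z : measurable (level_event z).
Proof. by rewrite /level_event; case: pickP => *; [exact: measurable_before | exact: measurable0]. Qed.

Lemma level_event_le z w : level_event z w -> X w <= z%:R.
Proof.
rewrite /level_event; case: pickP => // j /andP [jz _].
have jzR : (V j)%:R <= z%:R :> R by rewrite ler_nat.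
by rewrite /before; case: ifP => _ /= h; [apply: le_trans (ltW h) jzR | apply: le_trans h jzR].
Qed.

Lemma level_event_prob z : (((cdf z)%:R / D%:R)%:E <= P (level_event z))%E.
Proof.
have D0R : 0 < D%:R :> R by rewrite ltr0n.
rewrite /level_event; case: pickP => [j /andP [_ /eqP <-]|none].
  rewrite before_fin lee_fin ler_pdivrMr //; apply: le_trans (arc_pot_cdf_of j) _.
  by rewrite /cdf_of ltn_ord.
have [|[j [jN jz jc]]] := cdf_attained K V ql qu D z.
  by rewrite -/N -/pot -/cdf => ->; rewrite mul0r measure0.
have e : pot j == cdf z by rewrite /pot /cdf /N jc.
by have := none (Ordinal jN); rewrite /= jz e.
Qed.

Hypothesis support_prob : ql (K - 1) = D.

Lemma support_ae : P [set w | U%:R < X w] = 0%E.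
Proof.
have K1 : (K - 1 < K)%N by lia.
have KU : (K + (K - 1) = N - 1)%N by rewrite /N; lia.
have := constraints K1; rewrite support_prob KU divff ?pnatr_eq0 -?lt0n // => /andP [c1 _].
set I := [set w | (V (K - 1))%:R <= X w <= (V (N - 1)%N)%:R] in c1.
have mI : measurable I by have := measurable_between (K - 1); rewrite KU.
have mA : measurable [set w | U%:R < X w].
  have -> : [set w | U%:R < X w] = X @^-1` `]U%:R, +oo[.
    by apply/seteqP; split=> w /=; rewrite in_itv /= andbT.
  by rewrite -[X in measurable X]setTI; apply: mX => //; apply: measurable_itv.
apply/eqP; rewrite eq_le measure_ge0 andbT.
have sub : [set w | U%:R < X w] `<=` ~` I.
  by move=> w /= h /andP [_ h']; move: h; rewrite ltNge h'.
apply: le_trans (le_measure _ _ _ sub) _; rewrite ?inE //; first exact: measurableC.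
rewrite [X in (X <= _)%E](probability_setC P mI).
have : (P I <= 1)%E := probability_le1 _ mI; move: c1.
have -> : P I = (fine (P I))%:E by rewrite fineK // fin_num_measure.
by rewrite !lee_fin => h1 h2; lra.
Qed.

(** [X] is at most the number of integers [z] whose level event fails, and that
    number has expectation at most the sum of [1 - cdf z / D]. *)
Lemma arc_expectation_le :
  (\int[P]_w (Num.max (X w) 0)%:E <= ((arc_cost K V ql qu D)%:R / D%:R)%:E)%E.
Proof.
pose G (w : T) : \bar R := (\sum_(z <- index_iota 0 U) (\1_(~` level_event z) w)%:E)%E.
have mC z : measurable (~` level_event z).
  by apply: measurableC; apply: measurable_level_event.
have m1 z : measurable_fun setT (fun w => (\1_(~` level_event z) w)%:E : \bar R).
  by apply/measurable_EFinP; apply: measurable_indic.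
have mG : measurable_fun setT G by apply: emeasurable_sum.
have le_G : (\int[P]_w (Num.max (X w) 0)%:E <= \int[P]_w G w)%E.
  apply: ae_ge0_le_integral => //.
  - by move=> w _; rewrite lee_fin le_max lexx orbT.
  - by apply/measurable_EFinP; apply: measurable_maxr => //; apply: measurable_cst.
  - by move=> w _; apply: sume_ge0 => z _; rewrite lee_fin.
  exists [set w | U%:R < X w]; split.
  - have -> : [set w | U%:R < X w] = X @^-1` `]U%:R, +oo[.
      by apply/seteqP; split=> w /=; rewrite in_itv /= andbT.
    by rewrite -[X in measurable X]setTI; apply: mX => //; apply: measurable_itv.
  - exact: support_ae.
  move=> w /= H; rewrite ltNge; apply/negP => XU; apply: H => _.
  rewrite /G sumEFin lee_fin ge_max; apply/andP; split; last first.
    by apply: sumr_ge0 => z _.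
  apply: le_trans (le_count XU) _; apply: ler_sum => z _.
  rewrite indicE; case: (ltP z%:R (X w)) => // h.
  rewrite mem_set //= => /level_event_le h'; move: h; by rewrite ltNge h'.
apply: (le_trans le_G); rewrite ge0_integral_sum //.
have K1 : (K - 1 < K)%N by lia.
rewrite arc_costE //; last exact: arc_pot_le.
rewrite natr_sum mulr_suml -sumEFin; apply: lee_sum => z _.
rewrite integral_indic // setIT [X in (X <= _)%E](probability_setC P (measurable_level_event z)).
have := level_event_prob z; have mz := measurable_level_event z.
have -> : P (level_event z) = (fine (P (level_event z)))%:E by rewrite fineK // fin_num_measure.
have D0R : D%:R != 0 :> R by rewrite pnatr_eq0 -lt0n.
rewrite !lee_fin natrB; last exact: (cdf_le arc_pot_le).
by rewrite mulrBl divff // => h; rewrite lerD2l lerN2.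
Qed.

End ArcExpectation.

(** * The encoding of an instance *)

Section Encoding.
Local Open Scope nat_scope.

Lemma nth_flatten_blocks (I T : Type) (i0 : I) (x0 : T) (f : I -> seq T) (s : seq I) c i r :
  (forall j, size (f j) = c) -> i < size s -> r < c ->
  nth x0 (flatten [seq f j | j <- s]) (i * c + r) = nth x0 (f (nth i0 s i)) r.
Proof.
move=> fc; elim: s i => //= j s IH [_ rc|i]; first by rewrite nth_cat fc rc.
rewrite ltnS => si rc; rewrite nth_cat fc mulSn -addnA.
by rewrite [_ + _ < c]ltnNge leq_addr /= addKn IH.
Qed.

Lemma nth_flatten_offset (T : Type) (x0 : T) (ss : seq (seq T)) i j :
  j < size (nth [::] ss i) ->
  nth x0 (flatten ss) (sumn (take i (shape ss)) + j) = nth x0 (nth [::] ss i) j.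
Proof.
elim: ss i => [|s ss IH] [|i] //= js; first by rewrite add0n nth_cat js.
by rewrite nth_cat -addnA [_ + _ < size s]ltnNge leq_addr /= addKn IH.
Qed.

Lemma word_size_cat (w1 w2 : seq int) : word_size (w1 ++ w2) = word_size w1 + word_size w2.
Proof. exact: big_cat. Qed.

Lemma word_size_flatten (ws : seq (seq int)) :
  word_size (flatten ws) = \sum_(w <- ws) word_size w.
Proof.
elim: ws => [|w ws IH]; first by rewrite /word_size !big_nil.
by rewrite word_size_cat IH big_cons.
Qed.

Lemma size_le_word_size (w : seq int) : size w <= word_size w.
Proof. by rewrite /word_size -sum1_size; apply: leq_sum. Qed.

Lemma prod_den_le (s : seq rat) :
  \prod_(r <- s) `|denq r|%N <= 2 ^ word_size (flatten [seq encode_rat r | r <- s]).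
Proof.
rewrite word_size_flatten big_map.
elim: s => [|r s IH]; first by rewrite !big_nil.
rewrite !big_cons expnD leq_mul // /word_size /encode_rat !big_cons big_nil.
apply: leq_trans (ltnW (lt_expn_bitlen _)) _; rewrite leq_exp2l //; lia.
Qed.

End Encoding.

Section InstanceData.
Local Open Scope nat_scope.
Variable x : instance.

(** The program addresses arcs by natural numbers; out of range, a default value
    is used. *)
Definition on_arc (T : Type) (t0 : T) (f : 'I_(narcs x) -> T) (a : nat) : T :=
  oapp f t0 (insub a).

Lemma on_arcE T t0 (f : 'I_(narcs x) -> T) (a : 'I_(narcs x)) : on_arc t0 f a = f a.
Proof. by rewrite /on_arc valK. Qed.

Definition arc_rats (a : 'I_(narcs x)) : seq rat :=
  flatten [seq [:: lo i; up i; qlo i; qup i] | i <- enum 'I_(nextra a).+1].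

Definition arc_K : nat -> nat := on_arc 0 (fun a => (nextra a).+1).
Definition arc_tl : nat -> nat := on_arc 0 (fun a => arc_tail a : nat).
Definition arc_hd : nat -> nat := on_arc 0 (fun a => arc_head a : nat).
Definition arc_rat (a k : nat) : rat := nth 0%R (on_arc [::] arc_rats a) k.
Definition arc_num (a k : nat) : nat := `|numq (arc_rat a k)|%N.
Definition arc_den (a k : nat) : nat := `|denq (arc_rat a k)|%N.
Definition arc_off (a : nat) : nat := 4 + \sum_(0 <= b < a) (3 + arc_K b * 8).

Lemma size_arc_rats a : size (arc_rats a) = (nextra a).+1 * 4.
Proof.
rewrite /arc_rats size_flatten /shape -map_comp sumnE big_map /=.
by rewrite big_const_seq count_predT size_enum_ord iter_addn_0 mulnC.
Qed.

Lemma arc_ratE (a : 'I_(narcs x)) (i : 'I_(nextra a).+1) r : r < 4 ->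
  arc_rat a (i * 4 + r) = nth 0%R [:: lo i; up i; qlo i; qup i] r.
Proof.
move=> r4; rewrite /arc_rat on_arcE /arc_rats (nth_flatten_blocks ord0) ?size_enum_ord //.
by rewrite nth_ord_enum.
Qed.

Lemma encode_arcE a : encode_arc a =
  [:: Posz (arc_tail a); Posz (arc_head a); Posz (nextra a).+1] ++
  flatten [seq encode_rat r | r <- arc_rats a].
Proof.
rewrite /encode_arc /arc_rats; congr (_ ++ _).
by elim: (enum _) => //= i s ->.
Qed.

Lemma size_encode_arc (a : 'I_(narcs x)) : size (encode_arc a) = 3 + (nextra a).+1 * 8.
Proof.
rewrite encode_arcE /= size_flatten /shape -map_comp sumnE big_map /=.
rewrite big_const_seq count_predT size_arc_rats iter_addn_0; lia.
Qed.

Let arcs := [seq encode_arc a | a <- enum 'I_(narcs x)].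

Lemma nth_arcs (a : 'I_(narcs x)) : nth [::] arcs a = encode_arc a.
Proof. by rewrite /arcs (nth_map a) ?size_enum_ord // nth_ord_enum. Qed.

Lemma arc_offE a : a <= narcs x -> arc_off a = 4 + sumn (take a (shape arcs)).
Proof.
move=> aA; rewrite /arc_off; congr addn.
elim: a aA => [|a IH] aA; first by rewrite big_geq // take0.
have sz : size (shape arcs) = narcs x by rewrite size_map size_map size_enum_ord.
rewrite (take_nth 0) ?sz // sumn_rcons -IH ?(ltnW aA) // big_nat_recr //=; congr addn.
have /= nthE := nth_arcs (Ordinal aA).
have -> : nth 0 (shape arcs) a = size (nth [::] arcs a).
  by apply: nth_map; rewrite size_map size_enum_ord.
rewrite nthE size_encode_arc.
by rewrite /arc_K (on_arcE 0 _ (Ordinal aA)).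
Qed.

Lemma nth_encode (a : 'I_(narcs x)) j : j < 3 + (nextra a).+1 * 8 ->
  nth 0%R (encode_instance x) (arc_off a + j) = nth 0%R (encode_arc a) j.
Proof.
move=> jK; rewrite /encode_instance arc_offE ?(ltnW (ltn_ord a)) // -addnA nth_cat /=.
rewrite addKn -/arcs -(nth_arcs a) nth_flatten_offset // nth_arcs size_encode_arc; exact: jK.
Qed.

Lemma nth_encode_rat (a : 'I_(narcs x)) k r : k < (nextra a).+1 * 4 -> r < 2 ->
  nth 0%R (encode_instance x) (arc_off a + 3 + (k * 2 + r)) =
  nth 0%R (encode_rat (arc_rat a k)) r.
Proof.
move=> kK r2; rewrite -addnA nth_encode; last by lia.
rewrite encode_arcE nth_cat /= addKn.
rewrite (nth_flatten_blocks 0%R) ?size_arc_rats //.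
by rewrite /arc_rat on_arcE.
Qed.

Let W := word_size (encode_instance x).
Let io (i : nat) : nat := `|nth 0%R (encode_instance x) i|%N.

(** A product is at most as long as all its factors together; the header of the
    word makes the inequality strict. *)
Lemma denominator_lt : denominator (narcs x) arc_K arc_den < 2 ^ W.
Proof.
rewrite /denominator big_mkord.
apply: (@leq_ltn_trans (2 ^ \sum_(a < narcs x) word_size (encode_arc a))).
  rewrite expn_sum; apply: leq_prod => a _.
  rewrite encode_arcE word_size_cat /arc_K on_arcE big_mkord.
  apply: leq_trans (_ : 2 ^ word_size (flatten [seq encode_rat r | r <- arc_rats a]) <= _).
    apply: leq_trans (prod_den_le _); rewrite [X in _ <= X](big_nth 0%R) [X in _ <= X]big_mkord size_arc_rats.
    by apply: leq_prod => k _; rewrite /arc_den /arc_rat on_arcE.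
  by rewrite leq_exp2l //; lia.
rewrite ltn_exp2l // /W /encode_instance word_size_cat word_size_flatten big_map big_enum /=.
by rewrite -[X in X < _]add0n ltn_add2r /word_size big_cons.
Qed.

Lemma instance_layout :
  layout W (narcs x) (src x) (dst x) arc_K arc_tl arc_hd arc_off io arc_num arc_den.
Proof.
split.
- by [].
- by [].
- by [].
- by rewrite /arc_off big_geq.
- by move=> a; rewrite /arc_off big_nat_recr //=; lia.
- move=> a aA; rewrite /io -[arc_off a]addn0 (nth_encode (a := Ordinal aA)) //.
  by rewrite /arc_tl (on_arcE 0 _ (Ordinal aA)).
- move=> a aA; rewrite /io (nth_encode (a := Ordinal aA)) //.
  by rewrite /arc_hd (on_arcE 0 _ (Ordinal aA)).
- move=> a aA; rewrite /io (nth_encode (a := Ordinal aA)) //.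
  by rewrite /arc_K (on_arcE 0 _ (Ordinal aA)).
- move=> a k aA; rewrite /arc_K (on_arcE 0 _ (Ordinal aA)) => kK.
  by rewrite /io -[k * 2]addn0 (nth_encode_rat (a := Ordinal aA)).
- move=> a k aA; rewrite /arc_K (on_arcE 0 _ (Ordinal aA)) => kK.
  rewrite /io -[4]/(3 + 1) addnA -[_ + 1 + _]addnA [1 + _]addnC.
  by rewrite (nth_encode_rat (a := Ordinal aA)).
- by move=> i; rewrite /io; apply: lt_expn_word_size.
- apply: leq_trans (size_le_word_size _); rewrite arc_offE //.
  by rewrite /encode_instance size_cat /= size_flatten -/arcs take_oversize // size_map size_map size_enum_ord.
- by move=> a aA; rewrite /arc_K (on_arcE 0 _ (Ordinal aA)).
- exact: denominator_lt.
Qed.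

End InstanceData.

(** * The worst-case cost of a path *)

Section WorstCase.
Local Open Scope classical_set_scope.
Local Open Scope ring_scope.
Variables (R : realType) (x : instance).
Hypothesis valid : drsp_valid R x.

Let A := narcs x.
Let D := denominator A (arc_K x) (arc_den x).
Let V := endpoint A (arc_K x) (arc_num x) (arc_den x).
Let ql := prob_lo A (arc_K x) (arc_num x) (arc_den x).
Let qu := prob_up A (arc_K x) (arc_num x) (arc_den x).
Let cost := scaled_cost A (arc_K x) (arc_num x) (arc_den x).

Lemma arc_den_gt0 a k : (0 < arc_den x a k)%N.
Proof. by rewrite /arc_den absz_gt0 denq_neq0. Qed.

Lemma denominator_gt0 : (0 < D)%N.
Proof.
rewrite /D /denominator big_mkord prodn_cond_gt0 // => a _.
by rewrite big_mkord prodn_cond_gt0 // => k _; apply: arc_den_gt0.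
Qed.

Lemma DR_gt0 : 0 < D%:R :> R.
Proof. by rewrite ltr0n denominator_gt0. Qed.

Lemma arc_den_dvd (a : 'I_A) k : (k < arc_K x a * 4)%N -> (arc_den x a k %| D)%N.
Proof.
move=> kK; rewrite /D /denominator big_mkord (bigD1 a) //=; apply: dvdn_mulr.
by rewrite big_mkord (bigD1 (Ordinal kK)) //=; apply: dvdn_mulr.
Qed.

Lemma scaledE (a : 'I_A) k : (k < arc_K x a * 4)%N -> 0 <= arc_rat x a k ->
  (scaled A (arc_K x) (arc_num x) (arc_den x) a k)%:R = D%:R * ratr (arc_rat x a k) :> R.
Proof.
move=> kK r0; rewrite /scaled -/D natrM; have dvd := arc_den_dvd kK.
have d0 : (arc_den x a k)%:R != 0 :> R by rewrite pnatr_eq0 -lt0n arc_den_gt0.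
have -> : (D %/ arc_den x a k)%:R = D%:R / (arc_den x a k)%:R :> R.
  by apply: (mulIf d0); rewrite divfK // -natrM divnK.
rewrite /ratr -mulrA; congr (_ * _); rewrite mulrC; congr (_ / _).
  by rewrite /arc_num natr_absz ger0_norm // numq_ge0.
by rewrite /arc_den natr_absz ger0_norm // denq_ge0.
Qed.

Section OneArc.
Variable a : 'I_A.
Let K := (nextra a).+1.

Lemma arc_KE : arc_K x a = K.
Proof. by rewrite /arc_K on_arcE. Qed.

Lemma lo_ge0 (i : 'I_K) : 0 <= lo i.
Proof.
have [_ /(_ a) [l0 _ _ /(_ i) [[l1 _ _] _]] _ _] := valid.
exact: le_trans l0 l1.
Qed.

Lemma up_ge0 (i : 'I_K) : 0 <= up i.
Proof.
have [_ /(_ a) [l0 _ _ /(_ i) [[_ l1 _] _]] _ _] := valid.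
exact: le_trans (lo_ge0 i) l1.
Qed.

Lemma endpoint_lo (i : 'I_K) : (V a i)%:R = D%:R * ratr (lo i) :> R.
Proof.
have rE : arc_rat x a (i * 4) = lo i by rewrite -[(i * 4)%N]addn0 arc_ratE.
rewrite /V /endpoint arc_KE ltn_ord scaledE ?rE ?lo_ge0 //.
by rewrite arc_KE ltn_pmul2r.
Qed.

Lemma endpoint_up (i : 'I_K) : (V a (K + i)%N)%:R = D%:R * ratr (up i) :> R.
Proof.
rewrite /V /endpoint arc_KE ltnNge leq_addr /= addKn scaledE ?arc_ratE ?up_ge0 //.
by rewrite arc_KE; have := ltn_ord i; rewrite -/K; lia.
Qed.

Lemma prob_loE (i : 'I_K) : (ql a i)%:R = D%:R * ratr (qlo i) :> R.
Proof.
have [_ /(_ a) [_ _ _ /(_ i) [_ [q0 _ _]]] _ _] := valid.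
rewrite /ql /prob_lo scaledE ?arc_ratE //.
by rewrite arc_KE; have := ltn_ord i; rewrite -/K; lia.
Qed.

Lemma prob_upE (i : 'I_K) : (qu a i)%:R = D%:R * ratr (qup i) :> R.
Proof.
have [_ /(_ a) [_ _ _ /(_ i) [_ [q0 q1 _]]] _ _] := valid.
rewrite /qu /prob_up scaledE ?arc_ratE //; last exact: le_trans q0 q1.
by rewrite arc_KE; have := ltn_ord i; rewrite -/K; lia.
Qed.

Lemma endpoint_neq i j : (i < K)%N -> (j < K)%N -> V a i <> V a (K + j)%N.
Proof.
move=> iK jK E; have [_ _ _ /(_ a (Ordinal iK) (Ordinal jK)) [ne _]] := valid.
apply: ne; apply: (fmorph_inj (ratr : {rmorphism rat -> R})) => /=.
have /= e1 := endpoint_lo (Ordinal iK); have /= e2 := endpoint_up (Ordinal jK).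
have : D%:R * ratr (lo (Ordinal iK)) = D%:R * ratr (up (Ordinal jK)) :> R by rewrite -e1 -e2 E.
by apply: mulfI; rewrite gt_eqF // DR_gt0.
Qed.

Lemma endpoint_le_up i : (i < K)%N -> (V a i <= V a (K + i))%N.
Proof.
move=> iK; have [_ /(_ a) [_ _ _ /(_ (Ordinal iK)) [[_ l1 _] _]] _ _] := valid.
rewrite -(ler_nat R) (endpoint_lo (Ordinal iK)) (endpoint_up (Ordinal iK)).
by rewrite ler_pM2l ?DR_gt0 // ler_rat.
Qed.

Lemma support_prob_lo : ql a (K - 1)%N = D.
Proof.
have [_ /(_ a) [_ q1 _ _] _ _] := valid.
have := prob_loE ord_max; rewrite q1 rmorph1 mulr1 /K subn1 /= => /eqP.
by rewrite eqr_nat => /eqP.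
Qed.

Lemma endpoint_le_max j : (j < K + K)%N -> (V a j <= V a (K + K - 1))%N.
Proof.
have -> : (K + K - 1 = K + (ord_max : 'I_K))%N by rewrite /= /K; lia.
have [_ /(_ a) [_ _ _ dat] _ _] := valid.
move=> jK; rewrite -(ler_nat R) endpoint_up; case: (ltnP j K) => jK'.
  have [[_ l1 l2] _] := dat (Ordinal jK').
  rewrite (endpoint_lo (Ordinal jK')) ler_pM2l ?DR_gt0 // ler_rat; exact: le_trans l1 l2.
have jK2 : (j - K < K)%N by lia.
have [[_ _ l2] _] := dat (Ordinal jK2).
rewrite -(subnKC jK') (endpoint_up (Ordinal jK2)) ler_pM2l ?DR_gt0 // ler_rat; exact: l2.
Qed.

Lemma scaled_constraints d (T : measurableType d) (P : probability T R) (Y : T -> R) :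
  (forall i : 'I_K, ((ratr (qlo i))%:E <= P (Y @^-1` @subinterval R x a i) <= (ratr (qup i))%:E)%E) ->
  forall i, (i < K)%N ->
  (((ql a i)%:R / D%:R)%:E <= P [set w | ((V a i)%:R <= D%:R * Y w <= (V a (K + i)%N)%:R)%R]
                           <= ((qu a i)%:R / D%:R)%:E)%E.
Proof.
move=> H i iK; have := H (Ordinal iK).
have -> : Y @^-1` @subinterval R x a (Ordinal iK) =
          [set w | (V a i)%:R <= D%:R * Y w <= (V a (K + i)%N)%:R].
  apply/seteqP; split=> w /=;
    by rewrite (endpoint_lo (Ordinal iK)) (endpoint_up (Ordinal iK)) !ler_pM2l ?DR_gt0.
have D0 : D%:R != 0 :> R by rewrite gt_eqF // DR_gt0.
rewrite (prob_loE (Ordinal iK)) (prob_upE (Ordinal iK)).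
by rewrite ![D%:R * _]mulrC !mulfK.
Qed.

(** [assumption_A1] provides an admissible law of each arc, whose distribution
    function solves the difference constraints. *)
Lemma arc_consistent :
  [/\ closed_potential (cdf_edges K) (cdf_from K) (cdf_into K) (cdf_inc K (ql a))
        (cdf_dec K (V a) (qu a) D) (arc_pot A (arc_K x) (arc_num x) (arc_den x) a)
    & forall j, (arc_pot A (arc_K x) (arc_num x) (arc_den x) a j <= D)%N].
Proof.
have [_ _ /(_ a) [mu [H _]] _] := valid.
have C := @scaled_constraints _ _ mu (fun z : R => z) H.
have mX : measurable_fun setT (fun z : R => D%:R * z).
  by apply: measurable_funM => //; apply: measurable_cst.
rewrite /arc_pot arc_KE; split.
  exact: (arc_pot_closed mX (ltn0Sn _) denominator_gt0 endpoint_neq endpoint_le_up C).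
move=> j.
exact: (arc_pot_le mX (ltn0Sn _) denominator_gt0 endpoint_neq endpoint_le_up C).
Qed.

Lemma positive_part_le d (T : measurableType d) (P : probability T R) (Y : T -> R) :
  measurable_fun setT Y ->
  (forall i : 'I_K, ((ratr (qlo i))%:E <= P (Y @^-1` @subinterval R x a i) <= (ratr (qup i))%:E)%E) ->
  (\int[P]_w (Num.max (D%:R * Y w) 0)%:E <= ((cost a)%:R / D%:R)%:E)%E.
Proof.
move=> mY H; rewrite /cost /scaled_cost arc_KE.
have mX : measurable_fun setT (fun w => D%:R * Y w).
  by apply: measurable_funM => //; apply: measurable_cst.
exact: (arc_expectation_le mX (ltn0Sn _) denominator_gt0 endpoint_neq endpoint_le_up
  (scaled_constraints H) support_prob_lo).
Qed.

End OneArc.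

Lemma instance_consistent :
  arcs_consistent (word_size (encode_instance x)) A (arc_K x) (arc_num x) (arc_den x).
Proof.
move=> a aA; have [c1 c2] := arc_consistent (Ordinal aA).
have KE := arc_KE (Ordinal aA); rewrite /= in KE; rewrite KE; split=> //.
  by move=> j; apply: leq_ltn_trans (c2 j) (denominator_lt x).
exact: (endpoint_le_max (a := Ordinal aA)).
Qed.

Definition path_value (y : 'cV[int]_A) : R :=
  \sum_(a < A) (y a 0)%:~R * ((cost a)%:R / D%:R ^+ 2).

Lemma measurable_path_cost (y : 'cV[int]_A) : measurable_fun setT (@path_cost R x y).
Proof.
apply: measurable_sum => a; apply: measurable_funM; last exact: measurable_cst.
exact: measurable_tnth.
Qed.

(** Passing to positive parts avoids any integrability assumption: costs are
    nonnegative almost surely, and the bound is one for positive parts. *)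
Lemma expectation_path_cost_le (y : 'cV[int]_A) (Q : probability (A.-tuple R) R) :
  (forall a, 0 <= y a 0) -> @ambiguity_set R x Q ->
  ('E_Q[path_cost y] <= (path_value y)%:E)%E.
Proof.
move=> y0 amb; rewrite unlock integralE.
have D0 := DR_gt0.
pose f (a : 'I_A) (c : A.-tuple R) : R := (y a 0)%:~R / D%:R * Num.max (D%:R * tnth c a) 0.
have k0 a : 0 <= (y a 0)%:~R / D%:R :> R by rewrite divr_ge0 // ?ler0z // ltW.
have mt (a : 'I_A) : measurable_fun setT (fun c : A.-tuple R => tnth c a) by exact: measurable_tnth.
have mm (a : 'I_A) : measurable_fun setT (fun c : A.-tuple R => Num.max (D%:R * tnth c a) 0).
  apply: measurable_maxr; last exact: measurable_cst.
  by apply: measurable_funM => //; apply: measurable_cst.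
have mf a : measurable_fun setT (fun c => (f a c)%:E).
  by apply/measurable_EFinP; apply: measurable_funM => //; apply: measurable_cst.
have f0 a c : 0 <= f a c by rewrite mulr_ge0 // le_max lexx orbT.
apply: (@le_trans _ _ (\int[Q]_c ((fun c => (path_cost y c)%:E)^\+ c))%E).
  rewrite -[leRHS]adde0; apply: leeD2l; rewrite oppe_le0.
  by apply: integral_ge0 => c _.
apply: (@le_trans _ _ (\int[Q]_c \sum_(a <- index_enum 'I_A) (f a c)%:E)%E).
  apply: ge0_le_integral => //.
  - by apply: measurable_funepos; apply/measurable_EFinP; apply: measurable_path_cost.
  - by apply: emeasurable_sum.
  move=> c _; rewrite funeposE sumEFin -EFin_max lee_fin ge_max; apply/andP; split; last first.
    by apply: sumr_ge0.
  apply: ler_sum => a _; rewrite /f.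
  have -> : tnth c a * (y a 0)%:~R = (y a 0)%:~R / D%:R * (D%:R * tnth c a).
    by field; rewrite gt_eqF.
  by rewrite ler_wpM2l // le_max lexx.
rewrite ge0_integral_sum //; last by move=> a c _; rewrite lee_fin.
rewrite /path_value -sumEFin; apply: lee_sum => a _.
have -> : (fun c => (f a c)%:E) =
    (fun c => ((y a 0)%:~R / D%:R)%:E * (Num.max (D%:R * tnth c a) 0)%:E)%E by [].
rewrite ge0_integralZl_EFin //; last 2 first.
- by move=> c _; rewrite lee_fin le_max lexx orbT.
- exact/measurable_EFinP.
have -> : (y a 0)%:~R * ((cost a)%:R / D%:R ^+ 2) = (y a 0)%:~R / D%:R * ((cost a)%:R / D%:R) :> R.
  by field; rewrite gt_eqF.
rewrite [leRHS]EFinM lee_wpmul2l ?lee_fin //.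
apply: (positive_part_le (mt a)) => i.
exact: (amb a i).
Qed.

Let quant (a : 'I_A) := quantile (arc_K x a) (V a) (ql a) (qu a) D.

(** All arcs take their cost from the same level [w]: this comonotone coupling
    attains the worst case of every arc at once. The costs are lowered by [e / D]
    to keep them off the end points, which may fail to belong to the cells. *)
Definition worst_costs (e : R) (w : nat) : A.-tuple R :=
  [tuple ((quant a w)%:R - e) / D%:R | a < A].

Definition worst_law (e : R) : probability (A.-tuple R) R := uniform_atoms R (worst_costs e) D.

(** The level [w] falls into a subinterval when the quantile lies after its left
    end point and not after its right one: since [e < 1], lowering an integer by
    [e] turns the strict inequality into a weak one. *)
Lemma worst_law_ambiguous e : 0 < e < 1 -> @ambiguity_set R x (worst_law e).
Proof.
move=> /andP [e0 e1] a i; rewrite /marginal /pushforward /worst_law.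
rewrite [X in (_ <= X <= _)%E](uniform_atomsE R _ denominator_gt0).
have D0 := DR_gt0; have Dn0 : D%:R != 0 :> R by rewrite gt_eqF.
have [cl le_D] := arc_consistent a; set pot := arc_pot _ _ _ _ _ in cl le_D.
have KE := arc_KE a; set K := (nextra a).+1 in KE cl.
have iK : (i < K)%N := ltn_ord i.
have potE : pot = cdf_pot K (V a) (ql a) (qu a) D by rewrite /pot /arc_pot KE.
rewrite potE in cl le_D.
have count : \sum_(w < D) (worst_costs e w \in
      (fun c : A.-tuple R => tnth c a) @^-1` @subinterval R x a i)%:R =
    (pot (K + i) - pot i)%N%:R :> R.
  rewrite potE -(count_quantile_between (ltn0Sn _) cl le_D (endpoint_le_max (a := a))
    (support_prob_lo a) iK) big_mkord natr_sum.
  apply: eq_bigr => w _; congr (_%:R); congr nat_of_bool.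
  have lE := endpoint_lo i; have uE := endpoint_up i; rewrite -/K in uE.
  set q := quantile _ _ _ _ _ _.
  have tE : tnth (worst_costs e w) a = (q%:R - e) / D%:R by rewrite tnth_mktuple /quant KE.
  have loE : (ratr (lo i) <= (q%:R - e) / D%:R) = (V a i < q)%N.
    rewrite ler_pdivlMr // mulrC -lE; case: (ltnP (V a i) q) => h.
      have : ((V a i).+1%:R <= q%:R :> R) by rewrite ler_nat.
      by rewrite -natr1 => h'; apply/idP; lra.
    have : (q%:R <= (V a i)%:R :> R) by rewrite ler_nat.
    by move=> h'; apply/negbTE; rewrite -ltNge; lra.
  have upE : ((q%:R - e) / D%:R <= ratr (up i)) = (q <= V a (K + i))%N.
    rewrite ler_pdivrMr // mulrC -uE; case: (leqP q (V a (K + i))) => h.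
      have : (q%:R <= (V a (K + i))%:R :> R) by rewrite ler_nat.
      by move=> h'; apply/idP; lra.
    have : ((V a (K + i)).+1%:R <= q%:R :> R) by rewrite ler_nat.
    by rewrite -natr1 => h'; apply/negbTE; rewrite -ltNge; lra.
  by apply/idP/idP; rewrite inE /= /subinterval /= tE loE upE.
rewrite count potE !lee_fin.
have lo_pot := pot_lo (ltn0Sn _) cl iK; have up_pot := pot_up (ltn0Sn _) cl iK.
rewrite natrB; last exact: leq_trans (leq_addr _ _) lo_pot.
move: lo_pot up_pot; rewrite -!(ler_nat R) !natrD prob_loE prob_upE => h1 h2.
rewrite mulrC ler_pdivlMr // ler_pdivrMr //; apply/andP; split; lra.
Qed.

Lemma expectation_worst_law (y : 'cV[int]_A) e :
  ('E_(worst_law e)[path_cost y] =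
  (path_value y - e * ((\sum_(a < A) (y a 0)%:~R) / D%:R))%:E)%E.
Proof.
have D0 := DR_gt0.
rewrite uniform_atoms_expectation ?denominator_gt0 //; last exact: measurable_path_cost.
congr EFin; rewrite /path_cost exchange_big /=.
rewrite mulr_suml !mulr_sumr -sumrB; apply: eq_bigr => a _.
under eq_bigr do rewrite tnth_mktuple.
rewrite -mulr_suml -mulr_suml sumrB sumr_const card_ord -natr_sum.
rewrite -(big_mkord xpredT (quant a)) /quant sum_quantile.
- rewrite /cost /scaled_cost -/(V a) -/(ql a) -/(qu a) -/D -mulr_natr; field.
  by rewrite gt_eqF.
- by rewrite arc_KE.
- by have [_] := arc_consistent a; rewrite /arc_pot arc_KE.
Qed.

(** The supremum is approached as [e] tends to zero. *)
Lemma worst_case_costE (y : 'cV[int]_A) : (forall a, 0 <= y a 0) ->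
  @worst_case_cost R x y = (path_value y)%:E.
Proof.
move=> y0; apply/eqP; rewrite eq_le; apply/andP; split.
  by apply: ge_ereal_sup => _ [Q amb <-]; apply: expectation_path_cost_le.
apply/lee_addgt0Pr => t t0; pose s := (\sum_(a < A) (y a 0)%:~R) / D%:R : R.
have s0 : 0 <= s by rewrite divr_ge0 ?ler0n // sumr_ge0 // => a _; rewrite ler0z.
pose e := t / (t + s + 1).
have d0 : 0 < t + s + 1 by lra.
have e01 : 0 < e < 1 by rewrite /e divr_gt0 //= ltr_pdivrMr //; lra.
have es : e * s <= t.
  by rewrite /e mulrAC ler_pdivrMr //; nra.
apply: (@le_trans _ _ ('E_(worst_law e)[path_cost y] + t%:E)%E).
  by rewrite expectation_worst_law -EFinD lee_fin -/s; lra.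
apply: leeD2r; apply: ereal_sup_ubound; exists (worst_law e) => //.
exact: worst_law_ambiguous.
Qed.

End WorstCase.

(** * Shortest paths and the theorem *)

Section Paths.
Local Open Scope classical_set_scope.
Local Open Scope ring_scope.

Lemma Posz_sum (I : Type) (r : seq I) (p : pred I) (F : I -> nat) :
  (\sum_(i <- r | p i) F i)%N%:Z = \sum_(i <- r | p i) (F i)%:Z.
Proof. exact: (raddf_sum Posz). Qed.

Variables (R : realType) (x : instance).
Hypothesis valid : drsp_valid R x.

Let A := narcs x.
Let D := denominator A (arc_K x) (arc_den x).
Let cost := scaled_cost A (arc_K x) (arc_num x) (arc_den x).
Let prc := price A (arc_K x) (arc_num x) (arc_den x).
Let pot := route_pot A (dst x) (arc_K x) (arc_tl x) (arc_hd x) (arc_num x) (arc_den x).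
Let top := big A (arc_K x) (arc_num x) (arc_den x).

Lemma incidenceE i a :
  incidence x i a = (i == arc_tail a)%:R - (i == arc_head a)%:R.
Proof.
have [[_ /(_ a) ne _] _ _ _] := valid; rewrite mxE.
by case: eqP => [->|_]; [rewrite (negPf ne) | case: eqP].
Qed.

Lemma balanceE i : balance x i 0 = (i == src x)%:R - (i == dst x)%:R.
Proof.
have [[_ _ ne] _ _ _] := valid; rewrite mxE.
by case: eqP => [->|_]; [rewrite (negPf ne) | case: eqP].
Qed.

(** Flow balance, tested against a potential. *)
Lemma potential_drop (f : 'I_(nnodes x) -> int) (y : 'cV[int]_A) : @path_vectors x y ->
  \sum_a y a 0 * (f (arc_tail a) - f (arc_head a)) = f (src x) - f (dst x).
Proof.
case=> _ flow.
have pick (j : 'I_(nnodes x)) : \sum_i f i * (i == j)%:R = f j.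
  rewrite (bigD1 j) //= eqxx mulr1 big1 ?addr0 // => i /negPf ->.
  exact: mulr0.
transitivity (\sum_i f i * balance x i 0).
  rewrite -flow; under [RHS]eq_bigr do rewrite mxE mulr_sumr.
  rewrite exchange_big /=; apply: eq_bigr => a _.
  under eq_bigr do rewrite incidenceE mulrA.
  by rewrite -mulr_suml -[f (arc_tail a)]pick -[f (arc_head a)]pick -sumrB mulrC;
    congr (_ * _); apply: eq_bigr => i _; rewrite mulrBr.
by under eq_bigr do rewrite balanceE mulrBr; rewrite sumrB !pick.
Qed.

Definition total (F : nat -> nat) (y : 'cV[int]_A) : int := \sum_(a < A) y a 0 * (F a)%:Z.

Lemma path_vectors_ge0 (y : 'cV[int]_A) a : @path_vectors x y -> 0 <= y a 0.
Proof. by case=> /(_ a) [] ->. Qed.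

(** The potential is a dual solution: it bounds the price of every path vector
    from below. *)
Lemma price_ge (y : 'cV[int]_A) : @path_vectors x y -> top%:Z - (pot (src x))%:Z <= total prc y.
Proof.
move=> py; have := potential_drop (fun i => - (pot i)%:Z) py.
rewrite opprK addrC /pot route_pot_dst -/pot -/top => <-.
apply: ler_sum => a _; apply: ler_wpM2l; first exact: path_vectors_ge0.
have := @route_closed A (dst x) (arc_K x) (arc_tl x) (arc_hd x) (arc_num x) (arc_den x) a (ltn_ord a).
rewrite /gain -/pot -/prc /arc_tl /arc_hd !on_arcE; lia.
Qed.

Lemma total_le (F : nat -> nat) (y : 'cV[int]_A) : @path_vectors x y ->
  total F y <= (\sum_(0 <= a < A) F a)%N%:Z.
Proof.
move=> [y01 _]; rewrite big_mkord Posz_sum /total.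
by apply: ler_sum => a _; case: (y01 a) => ->; rewrite ?mul0r ?mul1r.
Qed.

Lemma total_price (y : 'cV[int]_A) : total prc y = total cost y * (A + 1)%:Z + total (fun=> 1%N) y.
Proof.
rewrite /total mulr_suml -big_split /=; apply: eq_bigr => a _.
by rewrite /prc /price -/(cost a) PoszD PoszM; ring.
Qed.

Lemma path_valueE (y : 'cV[int]_A) : path_value R y = (total cost y)%:~R / D%:R ^+ 2.
Proof.
rewrite /path_value /total raddf_sum mulr_suml; apply: eq_bigr => a _.
by rewrite /= intrM mulrA.
Qed.

(** A path vector costs at most the sum of all prices, and [big] exceeds it. *)
Lemma no_path : pot (src x) = 0%N -> @path_vectors x = set0.
Proof.
move=> p0; apply/seteqP; split=> // y py; have := price_ge py.
rewrite p0; have := total_le prc py; rewrite /top /big -/prc; lia.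
Qed.

Definition marks (Y : nat -> nat) : 'cV[int]_A := \col_a (Y a)%:Z.

Lemma walk_path Y : walk A (src x) (dst x) (arc_K x) (arc_tl x) (arc_hd x)
  (arc_num x) (arc_den x) (dst x) Y -> @path_vectors x (marks Y).
Proof.
move=> w; split; first by move=> a; rewrite mxE; case: (walk01 w a) => ->; [left | right].
apply/matrixP => i j; rewrite (ord1 j) balanceE mxE.
have sumE (g : 'I_A -> 'I_(nnodes x)) :
    \sum_a (i == g a)%:R * (Y a)%:Z = (\sum_(a < A | val (g a) == val i) Y a)%N%:Z :> int.
  rewrite Posz_sum [RHS]big_mkcond; apply: eq_bigr => a _.
  by rewrite eq_sym -val_eqE /=; case: eqP => _; rewrite ?mul1r ?mul0r.
under eq_bigr do rewrite incidenceE mxE mulrBl.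
rewrite sumrB !sumE; have := walk_flow w i; rewrite !big_mkord.
have tE : (fun a : 'I_A => arc_tl x a == val i) =1 (fun a => val (arc_tail a) == val i).
  by move=> a; rewrite /arc_tl on_arcE.
have hE : (fun a : 'I_A => arc_hd x a == val i) =1 (fun a => val (arc_head a) == val i).
  by move=> a; rewrite /arc_hd on_arcE.
rewrite (eq_bigl _ _ tE) (eq_bigl _ _ hE) -!val_eqE /=; lia.
Qed.

Variable Y : nat -> nat.
Hypothesis walkY : walk A (src x) (dst x) (arc_K x) (arc_tl x) (arc_hd x)
  (arc_num x) (arc_den x) (dst x) Y.

Lemma total_marks : total prc (marks Y) = top%:Z - (pot (src x))%:Z.
Proof.
have -> : total prc (marks Y) = (\sum_(0 <= a < A) Y a * prc a)%N%:Z.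
  by rewrite big_mkord Posz_sum; apply: eq_bigr => a _; rewrite mxE PoszM.
have := walk_cost walkY; rewrite route_pot_dst -/prc -/pot -/top => <-.
by rewrite PoszD addrK.
Qed.

Lemma marks_short (y : 'cV[int]_A) : @path_vectors x y -> 0 <= total (fun=> 1%N) y <= A%:Z.
Proof.
move=> py; have := total_le (fun=> 1%N) py; rewrite sum_nat_const_nat muln1 subn0 => ->.
by rewrite andbT sumr_ge0 // => a _; rewrite mulr1; apply: path_vectors_ge0.
Qed.

(** A path has at most [A] arcs, so the unit added to the cost of each arc is
    lost in the division by [A + 1]. *)
Lemma total_cost_marks : total cost (marks Y) = ((top - pot (src x)) %/ (A + 1))%N%:Z.
Proof.
have pY := walk_path walkY; have /andP [s0 sA] := marks_short pY.
have := total_marks; rewrite total_price.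
have le_top : (pot (src x) <= top)%N by apply: route_pot_max.
have c0 : 0 <= total cost (marks Y).
  by apply: sumr_ge0 => a _; apply: mulr_ge0 => //; apply: path_vectors_ge0.
case: (total cost (marks Y)) c0 => // c _.
case: (total (fun=> 1%N) (marks Y)) s0 sA => // n _ nA E.
have -> : (top - pot (src x) = c * (A + 1) + n)%N by lia.
by rewrite divnMDl ?addn1 // divn_small ?addn0 // ltnS; lia.
Qed.

(** Total prices differ from multiples of [A + 1] by at most [A], so their order
    determines that of the costs. *)
Lemma marks_optimal (y : 'cV[int]_A) : @path_vectors x y -> total cost (marks Y) <= total cost y.
Proof.
move=> py; have pY := walk_path walkY.
have /andP [s0 _] := marks_short pY; have /andP [_ sA] := marks_short py.
have := price_ge py; rewrite -total_marks !total_price => le_p.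
rewrite leNgt; apply/negP => lt.
have : (total cost y + 1) * (A + 1)%:Z <= total cost (marks Y) * (A + 1)%:Z.
  by apply: ler_wpM2r => //; lia.
by rewrite mulrDl; lia.
Qed.

Lemma marks_solution :
  @drsp_solution R x [seq Posz i | i <- path_word A (src x) (dst x) (arc_K x) (arc_tl x) (arc_hd x)
    (arc_num x) (arc_den x) Y].
Proof.
have pY := walk_path walkY; have D0 : 0 < D%:R :> R by apply: DR_gt0.
right; exists (marks Y), ((top - pot (src x)) %/ (A + 1))%N%:Z, (D * D)%N%:Z.
have valE y : @path_vectors x y -> @worst_case_cost R x y = ((total cost y)%:~R / D%:R ^+ 2)%:E.
  by move=> py; rewrite worst_case_costE // ?path_valueE // => a; apply: path_vectors_ge0.
have opt : @worst_case_cost R x (marks Y) = optimal_value R x.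
  apply/eqP; rewrite eq_le; apply/andP; split.
    apply: le_ereal_inf_tmp => _ [y py <-]; rewrite !valE // lee_fin.
    by rewrite ler_wpM2r ?invr_ge0 ?exprn_ge0 ?ler0n // ler_int marks_optimal.
  by apply: ereal_inf_lbound; exists (marks Y).
split=> //.
- by rewrite ltz_nat muln_gt0 !denominator_gt0.
- by rewrite -opt valE // total_cost_marks // PoszM intrM expr2.
rewrite /path_word map_cat; congr (_ ++ _).
rewrite /mkseq -val_enum_ord -!map_comp; apply: eq_map => a /=.
by rewrite mxE.
Qed.

End Paths.

Lemma instance_nonneg (R : realType) (x : instance) : drsp_valid R x ->
  all (fun z : int => (0 <= z)%R) (encode_instance x).
Proof.
move=> [_ dat _ _]; rewrite /encode_instance all_cat /=.
apply/allP => z /flattenP [s /mapP [a _ ->]]; rewrite /encode_arc mem_cat => /orP [|].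
  by rewrite !inE => /or3P [] /eqP ->.
move=> /flattenP [s' /mapP [i _ ->]].
have [l0 _ _ /(_ i) [[l1 l2 l3] [q1 q2 q3]]] := dat a.
have lo0 := le_trans l0 l1; have up0 := le_trans lo0 l2; have qu0 := le_trans q1 q2.
rewrite /encode_constraint /encode_rat !inE.
by do ![case/orP] => /eqP ->; rewrite ?numq_ge0 ?denq_ge0.
Qed.

Theorem theorem1 (R : realType) :
  polynomially_solvable encode_instance (drsp_valid R) (@drsp_solution R).
Proof.
(* The longest loops run over the edges of a difference constraint graph, which
   has [2 K <= W] nodes and hence at most [W * W + W] edges. *)
apply: (@compiled_polynomially_solvable _ _ _ _ drsp_prog (fun W => W * W + W)%N).
  by do ?[exact: poly_bounded_id | apply: poly_bounded_add | apply: poly_bounded_mul].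
move=> x valid; set w := encode_instance x; set W := word_size w.
have [safe_prog post] := @drsp_prog_correct (W * W + W) (W + 6) W _ _ _ _ _ _ _ _ _ _
  (word_store w) (instance_layout x) (leq_addr _ _) (leqnn _) (instance_consistent valid)
  (fun i => erefl) (fun a i ca => ifN _ _ ca).
split; [exact: instance_nonneg valid | exact: safe_prog |].
case: post => [[p0 out]|[p0 [Y wY out]]].
  exists [:: 0%R]; first by left; split=> //; apply: (no_path valid p0).
  by case=> // _; rewrite out.
exists [seq Posz i | i <- path_word (narcs x) (src x) (dst x) (arc_K x) (arc_tl x) (arc_hd x)
  (arc_num x) (arc_den x) Y]; first exact: marks_solution.
move=> i; rewrite size_map => iw; rewrite (nth_map 0%N) // out //.
by move: iw; rewrite /path_word size_cat size_mkseq addnC.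
Qed.
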